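(* Let $F=f+\psi$ satisfy Assumption A (see context), let $(x_k)_{k\ge 0}$ be generated by algorithm SCPG, and let the well-alignment Assumption B hold with parameters $\alpha,\delta\in(0,1)$. Additionally, assume that the sublevel set $\mathcal{L}_F(x_0)=\{x:F(x)\le F(x_0)\}$ is bounded and that $F$ satisfies the Kurdyka–Łojasiewicz (KL) property on $\mathcal{X}(x_0)$, the set of limit points of the subsequence $(x_{k_j})_{j\ge0}$ of well-aligned iterates, on which $F$ takes the constant value $F_*$; that is, there are $q>1$ and $\sigma_q,\gamma,\epsilon>0$ such that $$F(x)-F_*\le\sigma_q\|\nabla F(x)\|^q\quad\text{for all }x\text{ with }\mathrm{dist}(x,\mathcal{X}(x_0))\le\gamma,\ F_*<F(x)<F_*+\epsilon .$$ Let $\beta\in(0,1)$, $C=\frac{\alpha^2\eta_{\min}}{2H_{F,\max}^2}$, $\gamma_1=C\sigma_q^{-2/q}$, $\gamma_2=1-C\sigma_2^{-1}$, $C_1=\frac{2-q}{q}$ and $C_2=(1-\beta)(1-\delta)$. Then, for any $\bar\delta>0$, there exists $k_{j_{\bar\delta,\epsilon,\gamma}}>0$ such that for all $K$ satisfying $$K>\max\left(\frac{1+j_{\bar\delta,\epsilon,\gamma}}{(1-\beta)(1-\delta)}-1,\ k_{j_{\bar\delta,\epsilon,\gamma}}\right)$$ the sequence $(x_k)_{k\ge0}$ generated by SCPG satisfies the following statements with probability at least $1-\bar\delta$: (i) If $q\in(1,2)$, then the following sublinear rate holds: $$\mathbb{P}\left[F(x_K)-F_*\le\frac{1}{\left(\gamma_1C_1\left(C_2(K+1)-(j_{\bar\delta,\epsilon,\gamma}+1)\right)\right)^{\frac{q}{2-q}}}\right]\ge1-e^{-\frac{\beta^2}{2}(1-\delta)(K+1)}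 .$$ (ii) If $q=2$, then the following linear rate holds: $$\mathbb{P}\left[F(x_K)-F_*\le\gamma_2^{\,[C_2(K+1)-(j_{\bar\delta,\epsilon,\gamma}+1)]}\,(F(x_0)-F_* )\right]\ge1-e^{-\frac{\beta^2}{2}(1-\delta)(K+1)} .$$ (iii) If $q>2$, then with probability at least $1-\bar\delta$ the following superlinear rate holds: $$F(x_{k_{j+1}})-F_*\le\left(\frac{1}{1+C\sigma_q^{-\frac2q}\left(F(x_{k_{j+1}})-F_*\right)^{\frac2q-1}}\right)\left(F(x_{k_j})-F_*\right)\qquad\forall k_j\ge k_{j_{\bar\delta,\epsilon,\gamma}} .$$
   Context: Norms of vectors are Euclidean; norms of matrices are spectral unless marked $\|\cdot\|_F$ (Frobenius). Problem: $F^*=\min_{x\in\mathbb{R}^n}F(x)$, $F=f+\psi$. Assumption A: $\mathcal{U}\subset\mathbb{R}^{n\times p}$ is a bounded family of matrices. (A.1) $f:\mathbb{R}^n\to\mathbb{R}$ is continuously differentiable (possibly nonconvex) and for each $U\in\mathcal{U}$ there is $L_U$ with $\|U^T(\nabla f(x+Uh)-\nabla f(x))\|\le L_U\|h\|$ for all $x\in\mathbb{R}^n$, $h\in\mathbb{R}^p$. (A.2) $\psi:\mathbb{R}^n\to\mathbb{R}$ is simple (its proximal operator along the subspaces generated by $U\in\mathcal{U}$ is easy to compute) and twice continuously differentiable (possibly nonseparable and nonconvex). (A.3) A minimizer of $F$ exists (so $F^*>-\infty$). $\psi$ is convex along the subspaces from $\mathcal{U}$ if for every $x\in\mathbb{R}^n$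 and $U\in\mathcal{U}$ the function $d\mapsto\psi(x+Ud)$ is convex. Algorithm SCPG: given a starting point $x_0\in\mathbb{R}^n$, at each iteration $k\ge 0$ sample a random $U_k\sim\mathcal{U}$, choose $\eta_{U_k}>0$, set $H_{f,U_k}=\frac{L_{U_k}+\eta_{U_k}}{2}$ if $\psi$ is convex along the subspaces from $\mathcal{U}$, and $H_{f,U_k}=L_{U_k}+\eta_{U_k}$ otherwise; take $$d_k\in\arg\min_{d\in\mathbb{R}^p} f(x_k)+\langle U_k^T\nabla f(x_k),d\rangle+\frac{H_{f,U_k}}{2}\|d\|^2+\psi(x_k+U_kd)$$ and set $x_{k+1}=x_k+U_kd_k$. The sequence $F(x_k)$ is nonincreasing and bounded below; $F_*$ denotes its (almost sure) limit. Well-alignment: $U_k$ is well-aligned if $\|U_k^T\nabla F(x_k)\|\ge\alpha\|\nabla F(x_k)\|$, where $\alpha\in(0,1)$ is independent of the iteration $k$. The well-aligned iterations (those $k$ for which $U_k$ is well-aligned) are listed as $k_0<k_1<\cdots$; thus $k_{j_{\bar\delta,\epsilon,\gamma}}$ is the well-aligned iteration with index $j=j_{\bar\delta,\epsilon,\gamma}$ in this list. Assumption B: at each iteration $k$ the matrix $U_k$ is well-aligned for the fixed $\alpha\in(0,1)$ with probability at least $1-\delta$, $\delta\in(0,1)$, independently of the filtration $\{U_0,\dots,U_{k-1}\}$. Constants: for $z_1,\dots,z_n\in\mathbb{R}^n$ let $\bar\nabla^2\Psi(z_1,\dots,z_n)$ be the $n\times n$ matrix whose $i$-th row is the $i$-th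 row of the Hessian $\nabla^2\psi(z_i)$, and let $$H_{F,U_k}=\max_{z_1,\dots,z_n\in\mathrm{conv}(\mathcal{L}_F(x_0))}\|U_k^T\bar\nabla^2\Psi(z_1,\dots,z_n)U_k+H_{f,U_k}I_p\|_F .$$ $H_{F,\max}$ is a finite constant with $H_{F,U_k}\le H_{F,\max}$ for all $k\ge0$, and $\eta_{\min}=\min_k\eta_{U_k}>0$. *)

(* Defs.v *)
From HB Require Import structures.
From mathcomp Require Import all_boot all_order all_algebra.
From mathcomp Require Import all_classical all_reals all_analysis.

Set Implicit Arguments.
Unset Strict Implicit.
Unset Printing Implicit Defensive.

Import Order.TTheory GRing.Theory Num.Theory.
Import numFieldNormedType.Exports.

Local Open Scope classical_set_scope.
Local Open Scope ring_scope.

(* The norm `|_| that MathComp-Analysis puts on matrices is the max norm. It is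
   used here only for the topology, differentiability and boundedness, which do
   not depend on the choice of a norm; every quantitative norm is one of the
   two below. *)
Definition l2norm (R : realType) (n : nat) (v : 'cV[R]_n) : R :=
  Num.sqrt (\sum_(i < n) v i 0 ^+ 2).

Definition frobenius (R : realType) (m n : nat) (A : 'M[R]_(m, n)) : R :=
  Num.sqrt (\sum_(i < m) \sum_(j < n) A i j ^+ 2).

Definition dotv (R : realType) (n : nat) (u v : 'cV[R]_n) : R :=
  \sum_(i < n) u i 0 * v i 0.

(* inf set0 = 0, so the distance to the empty set is 0. *)
Definition dist_set (R : realType) (n : nat) (x : 'cV[R]_n)
    (A : set 'cV[R]_n) : R :=
  inf [set l2norm (x - y) | y in A].

Definition convex_hull (R : realType) (n : nat) (A : set 'cV[R]_n) :
    set 'cV[R]_n :=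
  smallest (@convex_set R 'cV[R]_n) A.

Definition grad (R : realType) (n : nat) (f : 'cV[R]_n -> R) (x : 'cV[R]_n) :
    'cV[R]_n :=
  \col_(i < n) 'D_(delta_mx i 0) f x.

Definition hess (R : realType) (n : nat) (f : 'cV[R]_n -> R) (x : 'cV[R]_n) :
    'M[R]_n :=
  \matrix_(i < n, j < n) grad (fun y => grad f y i 0) x j 0.

Definition C1_fun (R : realType) (n : nat) (f : 'cV[R]_n -> R) : Prop :=
  (forall x, differentiable f x) /\ continuous (grad f).

Definition C2_fun (R : realType) (n : nat) (f : 'cV[R]_n -> R) : Prop :=
  C1_fun f /\ forall i : 'I_n, C1_fun (fun x => grad f x i 0).

Definition sublevel (R : realType) (n : nat) (F : 'cV[R]_n -> R)
    (x0 : 'cV[R]_n) : set 'cV[R]_n :=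
  [set x | F x <= F x0].

Definition convex_along (R : realType) (n p : nat) (Us : set 'M[R]_(n, p))
    (psi : 'cV[R]_n -> R) : Prop :=
  forall (x : 'cV[R]_n) (U : 'M[R]_(n, p)), Us U ->
    @convex_function R 'cV[R]_p setT (fun d => psi (x + U *m d)).

Record assumption_A (R : realType) (n p : nat) (Us : set 'M[R]_(n, p))
    (L : 'M[R]_(n, p) -> R) (f psi : 'cV[R]_n -> R) : Prop := {
  A_bounded : bounded_set Us;
  A1_smooth : C1_fun f;
  A1_lipschitz : forall U, Us U -> forall (x : 'cV[R]_n) (h : 'cV[R]_p),
    l2norm (U^T *m (grad f (x + U *m h) - grad f x)) <= L U * l2norm h;
  A2_smooth : C2_fun psi;
  A3_minimizer : exists xmin, forall x, f xmin + psi xmin <= f x + psi x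
}.

Definition Hf (R : realType) (n p : nat) (Us : set 'M[R]_(n, p))
    (L : 'M[R]_(n, p) -> R) (psi : 'cV[R]_n -> R) (U : 'M[R]_(n, p)) (eta : R)
    : R :=
  if `[< convex_along Us psi >] then (L U + eta) / 2 else L U + eta.

Definition subproblem (R : realType) (n p : nat) (f psi : 'cV[R]_n -> R)
    (x : 'cV[R]_n) (U : 'M[R]_(n, p)) (H : R) (d : 'cV[R]_p) : R :=
  f x + dotv (U^T *m grad f x) d + H / 2 * l2norm d ^+ 2 + psi (x + U *m d).

Definition rowwise_hess (R : realType) (n : nat) (psi : 'cV[R]_n -> R)
    (z : 'I_n -> 'cV[R]_n) : 'M[R]_n :=
  \matrix_(i < n, j < n) hess psi (z i) i j.

(* When F is continuous with bounded sublevel set and psi is C^2, this supremum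
   is attained. *)
Definition HF (R : realType) (n p : nat) (F psi : 'cV[R]_n -> R)
    (x0 : 'cV[R]_n) (U : 'M[R]_(n, p)) (H : R) : R :=
  sup [set frobenius (U^T *m rowwise_hess psi z *m U + H%:M)
      | z in [set z : 'I_n -> 'cV[R]_n |
               forall i, convex_hull (sublevel F x0) (z i)]].

(* Measurability of X with respect to a sigma-algebra S on T and the Borel
   sigma-algebra of V: it is enough to test open sets. *)
Definition borel_measurable (T : Type) (V : topologicalType) (S : set (set T))
    (X : T -> V) : Prop :=
  forall O : set V, open O -> S (X @^-1` O).

(* The sigma-algebra generated by U_0, ..., U_{k-1}. *)
Definition history (T : Type) (V : topologicalType) (U : nat -> T -> V)
    (k : nat) : set (set T) :=
  <<s [set A | exists2 i, (i < k)%N & exists2 O, open O & A = U i @^-1` O] >>.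

(* The field x_adapted says that the samples are the only source of randomness:
   the choice of a minimizer d_k when there are several uses nothing but
   U_0, ..., U_k. The parameter eta may depend on the iteration and on the
   outcome, hence in particular on U_k. *)
Record SCPG (d : measure_display) (T : measurableType d) (R : realType)
    (n p : nat) (Us : set 'M[R]_(n, p)) (L : 'M[R]_(n, p) -> R)
    (f psi : 'cV[R]_n -> R) (x0 : 'cV[R]_n) (U : nat -> T -> 'M[R]_(n, p))
    (eta : nat -> T -> R) (dir : nat -> T -> 'cV[R]_p)
    (x : nat -> T -> 'cV[R]_n) : Prop := {
  U_measurable : forall k, borel_measurable measurable (U k);
  U_sampled : forall k w, Us (U k w);
  eta_gt0 : forall k w, 0 < eta k w;
  x_start : forall w, x 0%N w = x0;
  x_adapted : forall k, borel_measurable (history U k) (x k);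
  dir_argmin : forall k w (e : 'cV[R]_p),
    let H := Hf Us L psi (U k w) (eta k w) in
    subproblem f psi (x k w) (U k w) H (dir k w)
      <= subproblem f psi (x k w) (U k w) H e;
  x_step : forall k w, x k.+1 w = x k w + U k w *m dir k w
}.

Definition well_aligned (T : Type) (R : realType) (n p : nat)
    (F : 'cV[R]_n -> R) (alpha : R) (U : nat -> T -> 'M[R]_(n, p))
    (x : nat -> T -> 'cV[R]_n) (k : nat) : set T :=
  [set w | alpha * l2norm (grad F (x k w))
             <= l2norm ((U k w)^T *m grad F (x k w))].

(* "Well-aligned with probability at least 1 - delta independently of the past":
   P(W k | U_0, ..., U_{k-1}) >= 1 - delta almost surely, where the conditional
   probability is unfolded into its integral over each past event. *)
Definition assumption_B (d : measure_display) (T : measurableType d)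
    (R : realType) (P : probability T R) (n p : nat)
    (U : nat -> T -> 'M[R]_(n, p)) (W : nat -> set T) (delta : R) : Prop :=
  forall (k : nat) (A : set T), history U k A ->
    ((1 - delta)%:E * P A <= P (A `&` W k))%E.

(* The j-th (from 0) index k with w \in W k: exactly j smaller indices also
   qualify. The value is 0 if there are not that many indices. *)
Definition hit_index (T : Type) (W : nat -> set T) (j : nat) (w : T) : nat :=
  xget 0%N [set k | W k w /\ (\sum_(i < k) `[< W i w >])%N = j].

Definition limit_points (R : realType) (n : nat) (y : nat -> 'cV[R]_n) :
    set 'cV[R]_n :=
  cluster (y @ \oo).

Definition KL_property (R : realType) (n : nat) (F : 'cV[R]_n -> R)
    (X : set 'cV[R]_n) (Fs q sigma gam eps : R) : Prop :=
  (forall x, X x -> F x = Fs) /\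
  (forall x, dist_set x X <= gam -> Fs < F x < Fs + eps ->
     F x - Fs <= sigma * l2norm (grad F x) `^ q).

Definition cond_prob (d : measure_display) (T : measurableType d)
    (R : realType) (P : probability T R) (E A : set T) : R :=
  fine (P (A `&` E)) / fine (P E).

(* Main.v *)
(* Along one iteration F decreases by at least (eta / 2) |d_k|^2, and the
   optimality condition of the subproblem together with the mean value theorem
   bounds |U_k^T grad F(x_k)| by HFmax |d_k|. Hence a well-aligned iteration
   decreases F by C |grad F(x_k)|^2, and with the KL inequality
   D = F(x_k) - F_* satisfies D' <= D - gamma1 D^(2/q); the three rates follow
   with the number of well-aligned iterations as clock.

   The number of well-aligned iterations before time k is stochastically at least
   binomial, so by Borel-Cantelli it almost surely eventually exceeds
   (1 - beta)(1 - delta) k. By compactness almost every path eventually stays in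
   the KL region at well-aligned times. Both statements concern all times k >= M,
   so they hold together on an event E of probability at least 1 - delta' as soon
   as M is large. *)
Require Import Defs.
From HB Require Import structures.
From mathcomp Require Import all_boot all_order all_algebra.
From mathcomp Require Import all_classical all_reals all_analysis.
From mathcomp Require Import measurable_realfun ring lra.

Set Implicit Arguments.
Unset Strict Implicit.
Unset Printing Implicit Defensive.

Import Order.TTheory GRing.Theory Num.Theory.
Import numFieldNormedType.Exports.

Local Open Scope classical_set_scope.
Local Open Scope ring_scope.

(** * Euclidean geometry of column vectors *)

Section Euclidean.
Context {R : realType}.

Lemma dotvE n (u v : 'cV[R]_n) : dotv u v = (u^T *m v) 0 0.
Proof. by rewrite mxE; apply: eq_bigr => i _; rewrite mxE. Qed.

Lemma dotvC n (u v : 'cV[R]_n) : dotv u v = dotv v u.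
Proof. by apply: eq_bigr => i _; rewrite mulrC. Qed.

Lemma dotvDl n (u v w : 'cV[R]_n) : dotv (u + v) w = dotv u w + dotv v w.
Proof. by rewrite !dotvE linearD mulmxDl mxE. Qed.

Lemma dotvZl n a (u w : 'cV[R]_n) : dotv (a *: u) w = a * dotv u w.
Proof. by rewrite !dotvE linearZ -scalemxAl mxE. Qed.

Lemma dotvBl n (u v w : 'cV[R]_n) : dotv (u - v) w = dotv u w - dotv v w.
Proof. by rewrite -scaleN1r dotvDl dotvZl mulN1r. Qed.

Lemma dotvDr n (u v w : 'cV[R]_n) : dotv u (v + w) = dotv u v + dotv u w.
Proof. by rewrite !(dotvC u) dotvDl. Qed.

Lemma dotvZr n a (u v : 'cV[R]_n) : dotv u (a *: v) = a * dotv u v.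
Proof. by rewrite !(dotvC u) dotvZl. Qed.

Lemma dotv0 n (u : 'cV[R]_n) : dotv u 0 = 0.
Proof. by rewrite -(scale0r 0) dotvZr mul0r. Qed.

Lemma dotv_mull m n (A : 'M[R]_(m, n)) (u : 'cV_m) (v : 'cV_n) :
  dotv (A^T *m u) v = dotv u (A *m v).
Proof. by rewrite !dotvE trmx_mul trmxK mulmxA. Qed.

Lemma dotvv_ge0 n (u : 'cV[R]_n) : 0 <= dotv u u.
Proof. by apply: sumr_ge0 => i _; rewrite -expr2 sqr_ge0. Qed.

Lemma dotvv_eq0 n (u : 'cV[R]_n) : dotv u u = 0 -> u = 0.
Proof.
move=> u0; apply/colP => i; rewrite mxE; apply/eqP; rewrite -sqrf_eq0 expr2.
by apply/eqP/(psumr_eq0P _ u0) => // j _; rewrite -expr2 sqr_ge0.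
Qed.

Lemma l2normE n (u : 'cV[R]_n) : l2norm u = Num.sqrt (dotv u u).
Proof. by congr Num.sqrt; apply: eq_bigr => i _; rewrite expr2. Qed.

Lemma l2norm_ge0 n (u : 'cV[R]_n) : 0 <= l2norm u.
Proof. exact: sqrtr_ge0. Qed.

Lemma sqr_l2norm n (u : 'cV[R]_n) : l2norm u ^+ 2 = dotv u u.
Proof. by rewrite l2normE sqr_sqrtr// dotvv_ge0. Qed.

Lemma l2norm0 n : l2norm (0 : 'cV[R]_n) = 0.
Proof. by rewrite l2normE dotv0 sqrtr0. Qed.

Lemma l2normZ n a (u : 'cV[R]_n) : l2norm (a *: u) = `|a| * l2norm u.
Proof.
by rewrite !l2normE dotvZl dotvZr mulrA -expr2 sqrtrM ?sqr_ge0// sqrtr_sqr.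
Qed.

Lemma l2normB_sym n (u v : 'cV[R]_n) : l2norm (u - v) = l2norm (v - u).
Proof. by rewrite -opprB -scaleN1r l2normZ normrN1 mul1r. Qed.

(** Cauchy-Schwarz: the squared norm of [dotv v v *: u - dotv u v *: v] is [dotv v v] times the
    difference of the two sides. *)
Lemma dotv_sqr_le n (u v : 'cV[R]_n) : dotv u v ^+ 2 <= dotv u u * dotv v v.
Proof.
have [v0|vn0] := eqVneq (dotv v v) 0.
  have -> : dotv u v = 0 by rewrite (dotvv_eq0 v0) dotv0.
  by rewrite expr0n v0 mulr0.
have a0 : 0 < dotv v v by rewrite lt_neqAle eq_sym vn0 dotvv_ge0.
have := dotvv_ge0 (dotv v v *: u + (- dotv u v) *: v).
rewrite !(dotvDl, dotvDr, dotvZl, dotvZr) (dotvC v u) => h.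
rewrite -subr_ge0 -(pmulr_rge0 _ a0); apply: le_trans h _.
by rewrite le_eqVlt; apply/orP; left; apply/eqP; ring.
Qed.

Lemma dotv_le n (u v : 'cV[R]_n) : dotv u v <= l2norm u * l2norm v.
Proof.
apply: le_trans (ler_norm _) _.
rewrite -sqrtr_sqr !l2normE -sqrtrM ?dotvv_ge0//.
by rewrite ler_sqrt ?dotv_sqr_le// mulr_ge0 ?dotvv_ge0.
Qed.

Lemma l2normD n (u v : 'cV[R]_n) : l2norm (u + v) <= l2norm u + l2norm v.
Proof.
rewrite -ler_sqr ?nnegrE ?addr_ge0 ?l2norm_ge0// sqr_l2norm sqrrD !sqr_l2norm.
rewrite !(dotvDl, dotvDr) (dotvC v u); have := dotv_le u v; lra.
Qed.

Lemma l2norm_mulmx m n (A : 'M[R]_(m, n)) (v : 'cV_n) :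
  l2norm (A *m v) <= frobenius A * l2norm v.
Proof.
rewrite l2normE /frobenius [l2norm v]l2normE -sqrtrM; last first.
  by apply: sumr_ge0 => i _; apply: sumr_ge0 => j _; exact: sqr_ge0.
rewrite ler_wsqrtr// mulr_suml; apply: ler_sum => i _; rewrite -expr2.
have -> : (A *m v) i 0 = dotv (row i A)^T v.
  by rewrite mxE; apply: eq_bigr => j _; rewrite !mxE.
apply: le_trans (dotv_sqr_le _ _) _; rewrite ler_wpM2r ?dotvv_ge0//.
rewrite le_eqVlt; apply/orP; left; apply/eqP/eq_bigr => j _.
by rewrite !mxE expr2.
Qed.

Lemma continuous_bigsum (V : topologicalType) (I : Type) (r : seq I)
    (f : I -> V -> R) :
  (forall i, continuous (f i)) -> continuous (fun x => \sum_(i <- r) f i x).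
Proof.
move=> cf; elim: r => [|i r IHr].
  by under eq_fun do rewrite big_nil; exact: cst_continuous.
under eq_fun do rewrite big_cons.
by move=> x; apply: continuousD; [exact: cf | exact: IHr].
Qed.

Lemma continuous_dotv (V : topologicalType) n (f g : V -> 'cV[R]_n) :
  (forall i, continuous (fun x => f x i 0)) ->
  (forall i, continuous (fun x => g x i 0)) ->
  continuous (fun x => dotv (f x) (g x)).
Proof.
move=> cf cg; apply: continuous_bigsum => i x.
by apply: continuousM; [exact: cf | exact: cg].
Qed.

Lemma l2norm_continuous n : continuous (@l2norm R n).
Proof.
move=> v; rewrite (_ : @l2norm R n = Num.sqrt \o (fun u => dotv u u)).
  apply: continuous_comp; last exact: sqrt_continuous.
  by apply: continuous_dotv => i; exact: coord_continuous.
by apply/funext => u; rewrite l2normE.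
Qed.

Lemma continuous_mx (V : topologicalType) m n (f : V -> 'M[R]_(m, n)) :
  (forall i j, continuous (fun x => f x i j)) -> continuous f.
Proof.
move=> cf x A [B nB sBA].
suff : \forall y \near x, forall i j, B i j (f y i j).
  by apply: filterS => y By; apply: sBA.
by apply: filter_forall => i; apply: filter_forall => j; exact/cf/nB.
Qed.

Lemma mx_coord_le_norm m n (A : 'M[R]_(m, n)) i j : `|A i j| <= `|A|.
Proof.
rewrite [leRHS]/Num.Def.normr /= mx_normrE.
exact: (le_bigmax _ (fun k => `|A k.1 k.2|) (i, j)).
Qed.

Lemma cV_bounded_closed_compact n (A : set 'cV[R]_n) :
  bounded_set A -> closed A -> compact A.
Proof.
move=> bA cA.
have ctr k l : continuous (@trmx R k l).
  apply: continuous_mx => i j x.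
  by under eq_fun do rewrite mxE; exact: coord_continuous.
have -> : A = trmx @` [set v : 'rV[R]_n | A v^T].
  apply/seteqP; split => [v Av|_ [v Av <-]//]; exists v^T; rewrite ?trmxK//=.
  by rewrite trmxK.
apply: continuous_compact; first exact/continuous_subspaceT/ctr.
apply: bounded_closed_compact; last first.
  exact: (closed_comp (fun x _ => ctr _ _ x) cA).
case: bA => M [Mr hM]; exists M; split=> // N MN v /= Av.
apply: le_trans (hM N MN _ Av); rewrite [leLHS]/Num.Def.normr /= mx_normrE.
apply/bigmax_leP; split=> // ij _; have := mx_coord_le_norm v^T ij.2 ij.1.
by rewrite mxE.
Qed.

Lemma compact_norm_le n (M : R) : compact [set v : 'cV[R]_n | `|v| <= M].
Proof.
apply: cV_bounded_closed_compact.
  exists M; split; first exact: num_real.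
  by move=> N MN v /= vM; rewrite (le_trans vM)// ltW.
exact: (@preimage_closed _ _ _ [set r : R | r <= M]
  (fun v _ => @norm_continuous _ _ v) (@closed_le _ M)).
Qed.

End Euclidean.

(** * Gradients and derivatives along lines *)

Section Calculus.
Context {R : realType} {n : nat}.
Implicit Types (f g : 'cV[R]_n -> R) (a b v x : 'cV[R]_n).

Lemma derive_grad f a b : differentiable f a -> 'D_b f a = dotv (grad f a) b.
Proof.
move=> df; rewrite deriveE// {1}[b]matrix_sum_delta linear_sum /=.
apply: eq_bigr => i _; rewrite big_ord1 linearZ /= mxE deriveE// mulrC.
by [].
Qed.

Lemma is_derive_path f a b t : differentiable f (a + t *: b) ->
  is_derive t 1 (fun s => f (a + s *: b)) (dotv (grad f (a + t *: b)) b).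
Proof.
move=> df.
have dp : is_diff t (fun s : R => a + s *: b) (0 + *:%R ^~ b).
  exact: (@is_diffD R R 'cV[R]_n (cst a) ( *:%R ^~ b) 0 ( *:%R ^~ b) t).
have dfp : is_diff (a + t *: b) f ('d f (a + t *: b)) by exact: differentiableP.
have dc := @is_diff_comp _ _ _ _ _ _ _ _ t dp dfp.
apply: DeriveDef; first by apply/derivable1_diffP; exact: ex_diff.
rewrite deriveE; last exact: ex_diff.
by rewrite (@diff_val _ _ _ _ _ _ _ dc) /= add0r scale1r -derive_grad// deriveE.
Qed.

Lemma gradD f g x : differentiable f x -> differentiable g x ->
  grad (fun y => f y + g y) x = grad f x + grad g x.
Proof.
move=> df dg; apply/colP => i; rewrite !mxE.
by rewrite deriveD//; exact: diff_derivable.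
Qed.

End Calculus.

(** * One step of the algorithm *)

Section Step.
Context {R : realType} {n p : nat}.
Implicit Types (f psi : 'cV[R]_n -> R) (x : 'cV[R]_n) (U : 'M[R]_(n, p)).

Lemma is_derive_quadratic (a b c t : R) :
  is_derive t 1 (fun s : R => a + s * b + s ^+ 2 * c) (b + 2 * t * c).
Proof.
have -> : (fun s : R => a + s * b + s ^+ 2 * c)
    = cst a + b *: (@id R) + c *: (@id R) ^+ 2.
  by apply/funext => u; rewrite mulrC [_ ^+ 2 * _]mulrC.
apply: is_derive_eq; rewrite /GRing.scale /= !mulr1 expr1 add0r.
by rewrite [c * _]mulrC.
Qed.

(** The difference [phi] between f along the segment and the quadratic is nonincreasing on [0, 1]:
    by Cauchy-Schwarz and the Lipschitz bound for the displacement [s *: h], its derivative is at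
    most 0. *)
Lemma descent_lemma f x U (h : 'cV[R]_p) L :
  (forall y, differentiable f y) ->
  (forall y k,
    l2norm (U^T *m (grad f (y + U *m k) - grad f y)) <= L * l2norm k) ->
  f (x + U *m h) <= f x + dotv (U^T *m grad f x) h + L / 2 * l2norm h ^+ 2.
Proof.
move=> df lf; set A := dotv _ h; set B := L / 2 * _.
pose phi := ((fun s => f (x + s *: (U *m h))) : R -> R)
  - (fun s => 0 + s * A + s ^+ 2 * B).
have dphi (s : R) : is_derive s 1 phi
    (dotv (grad f (x + s *: (U *m h))) (U *m h) - (A + (2 * s) * B)).
  apply: is_deriveB; first exact: is_derive_path.
  exact: is_derive_quadratic.
have phi1 : phi 1 = f (x + U *m h) - (A + B).
  by rewrite /phi !fctE /= scale1r mul1r expr1n mul1r add0r.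
have phi0 : phi 0 = f x.
  by rewrite /phi !fctE /= scale0r mul0r expr0n mul0r !addr0 subr0.
suff : phi 1 <= phi 0 by rewrite phi1 phi0; lra.
apply: (@ler0_derive1_le_cc _ phi 0 1); rewrite ?in_itv /= ?lexx ?ler01//.
- move=> s; rewrite in_itv /= => /andP[s0 _].
  rewrite derive1E (@derive_val _ _ _ _ _ _ _ (dphi s)) opprD addrA.
  have -> : A = dotv (grad f x) (U *m h) by rewrite /A dotv_mull.
  rewrite -dotvBl -dotv_mull scalemxAr subr_le0.
  apply: le_trans (dotv_le _ _) _.
  apply: le_trans (ler_wpM2r (l2norm_ge0 _) (lf x (s *: h))) _.
  by rewrite l2normZ gtr0_norm// /B expr2; lra.
- by apply: derivable_within_continuous => s _; case: (dphi s).
Qed.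

(** The product of the residual with any direction [v] is the derivative at 0 of the model along
    [d + t *: v], which is minimal at t = 0. The residual is therefore orthogonal to itself. *)
Lemma subproblem_stationary f psi x U H (d : 'cV[R]_p) :
  (forall y, differentiable psi y) ->
  (forall e, subproblem f psi x U H d <= subproblem f psi x U H e) ->
  U^T *m grad f x + H *: d + U^T *m grad psi (x + U *m d) = 0.
Proof.
move=> dpsi dmin; apply: dotvv_eq0; move: (X in dotv _ X) => v.
rewrite !dotvDl dotvZl [in X in _ + X]dotv_mull.
set g := grad f x.
pose theta := ((fun t => psi (x + U *m d + t *: (U *m v))) : R -> R)
  + (fun t => f x + dotv (U^T *m g) d + H / 2 * dotv d d
              + t * (dotv (U^T *m g) v + H * dotv d v)
              + t ^+ 2 * (H / 2 * dotv v v)).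
have thetaE t : theta t = subproblem f psi x U H (d + t *: v).
  rewrite /theta /subproblem !fctE sqr_l2norm mulmxDr -scalemxAr.
  rewrite [x + (_ + _)]addrA -/g.
  by rewrite !(dotvDl, dotvDr, dotvZl, dotvZr) (dotvC v d); field.
have dtheta (t : R) : is_derive t 1 theta
    (dotv (grad psi (x + U *m d + t *: (U *m v))) (U *m v)
     + (dotv (U^T *m g) v + H * dotv d v + 2 * t * (H / 2 * dotv v v))).
  apply: is_deriveD; first exact: is_derive_path.
  exact: is_derive_quadratic.
have d0 : is_derive (0 : R) 1 theta 0.
  apply: (@derive1_at_min _ theta (-1) 1).
  - lra.
  - by move=> t _; case: (dtheta t).
  - by rewrite in_itv /= ltrN10 ltr01.
  - by move=> t _; rewrite !thetaE scale0r addr0.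
have := @derive_val _ _ _ _ _ _ _ d0.
rewrite (@derive_val _ _ _ _ _ _ _ (dtheta 0)) scale0r addr0.
by rewrite mulr0 mul0r addr0 => <-; rewrite addrC.
Qed.


Lemma convex_alongE (Us : set 'M[R]_(n, p)) psi x U (d : 'cV[R]_p) (t : R) :
  convex_along Us psi -> Us U -> 0 <= t <= 1 ->
  psi (x + U *m (t *: d)) <= t * psi (x + U *m d) + (1 - t) * psi x.
Proof.
move=> cpsi UsU /andP[t0 t1].
have := cpsi x U UsU (Itv01 t0 t1) d 0; rewrite !inE => /(_ Logic.I Logic.I).
by rewrite convRE mulmx0 addr0 /conv /= scaler0 addr0.
Qed.

(** Passage to the limit t -> 0: if c < a and 0 < b, then t = (a - c) / (2 b) gives a - t b = (a +
    c) / 2 > c. The instance t = 1/2 ensures that this t is below 1. *)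
Lemma ler_of_small (a b c : R) :
  (forall t, 0 < t < 1 -> a - t * b <= c) -> a <= c.
Proof.
move=> h; rewrite leNgt; apply/negP => ca.
have [b0|b0] := leP b 0.
  by have := h 2^-1 _; rewrite !invr_gt0 ltr0n invf_lt1 ?ltr1n// => /(_ isT); lra.
have h2 := h 2^-1 _; rewrite !invr_gt0 ltr0n invf_lt1 ?ltr1n// in h2.
have {}h2 := h2 isT.
have t0 : 0 < (a - c) / (2 * b) by rewrite divr_gt0//; lra.
have := h ((a - c) / (2 * b)); rewrite t0 ltr_pdivrMr ?mul1r; last lra.
have -> : (a - c) / (2 * b) * b = (a - c) / 2 by field; rewrite gt_eqF.
have -> : a - c < 2 * b by lra.
by move=> /(_ isT); lra.
Qed.

(* When psi is convex along U, comparing d with (1 - t) d and letting t tend to 0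
   gains H |d|^2 instead of H / 2 |d|^2; this is what allows H to be halved. *)
Lemma scpg_decrease (Us : set 'M[R]_(n, p)) (L : 'M[R]_(n, p) -> R) f psi x U
    eta (d : 'cV[R]_p) :
  assumption_A Us L f psi -> Us U ->
  (forall e, subproblem f psi x U (Hf Us L psi U eta) d
             <= subproblem f psi x U (Hf Us L psi U eta) e) ->
  f (x + U *m d) + psi (x + U *m d) <= f x + psi x - eta / 2 * l2norm d ^+ 2.
Proof.
move=> hA UsU dmin.
have fle : f (x + U *m d) <= _ :=
  descent_lemma x d (A1_smooth hA).1 (A1_lipschitz hA UsU).
set g := dotv _ d in fle; set D := l2norm d ^+ 2 in fle *.
move: dmin; rewrite /Hf; case: asboolP => [cpsi|_] dmin; last first.
  have := dmin 0; rewrite /subproblem mulmx0 addr0 l2norm0.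
  rewrite dotv0 -/g -/D; nra.
suff : g + (L U + eta) / 2 * D + psi (x + U *m d) <= psi x by lra.
(* Comparing with [(1 - t) *: d] and dividing by t gives the inequality up to the error t (H / 2) D,
   where H = (L U + eta) / 2. *)
apply: (@ler_of_small _ ((L U + eta) / 2 / 2 * D)) => t /andP[t0 t1].
have := dmin ((1 - t) *: d); rewrite /subproblem dotvZr l2normZ exprMn -/g -/D.
rewrite real_normK ?num_real//.
have := @convex_alongE Us psi x U d (1 - t) cpsi UsU; rewrite subr_ge0 (ltW t1).
rewrite lerBlDr lerDl (ltW t0) => /(_ isT).
set y := psi (x + U *m d); set y0 := psi x; set yt := psi _.
move=> h1 h2; rewrite -(ler_pM2l t0); set H := (L U + eta) / 2 in h2 *.
nra.
Qed.

End Step.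

(** * Bounding the gradient along U by the step length *)

Section GradientBound.
Context {R : realType} {n p : nat}.
Implicit Types (f psi : 'cV[R]_n -> R) (x y : 'cV[R]_n) (U : 'M[R]_(n, p)).

Lemma convex_hull_segment (A : set 'cV[R]_n) x y (s : R) :
  A x -> A y -> 0 <= s <= 1 -> convex_hull A (x + s *: (y - x)).
Proof.
move=> Ax Ay /andP[s0 s1] B [cB AB].
have := cB y x (Itv01 s0 s1); rewrite !inE => /(_ (AB _ Ay) (AB _ Ax)).
rewrite /conv /= /unstable.onem scalerBl scale1r scalerBr.
by rewrite [in X in _ -> X]addrCA.
Qed.

Lemma convex_hull_bounded (A : set 'cV[R]_n) : bounded_set A ->
  exists M, forall z, convex_hull A z -> `|z| <= M.
Proof.
move=> [M [_ /(_ (M + 1))]]; rewrite ltrDl ltr01 => /(_ isT) hM.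
exists (M + 1) => z hz; apply: (hz [set u | `|u| <= M + 1]).
split=> [u v t|u Au]; last exact: hM.
rewrite !inE /conv /= => hu hv; apply: le_trans (ler_normD _ _) _.
rewrite !normrZ ger0_norm ?ge0// ger0_norm ?subr_ge0 ?le1//.
have t0 : 0 <= t%:num by []. have t1 : t%:num <= 1 by [].
rewrite /unstable.onem; nra.
Qed.

(** The scalar mean value theorem is applied to each component of the gradient. Its intermediate
    point depends on the component, so each row of the Hessian is taken at a point of its own. *)
Lemma grad_diff_rowwise psi x y : C2_fun psi ->
  exists2 z : 'I_n -> 'cV[R]_n,
    forall i, exists2 s, 0 <= s <= 1 & z i = x + s *: (y - x) &
    grad psi y - grad psi x = rowwise_hess psi z *m (y - x).
Proof.
move=> [_ d2].
have mvt i : exists s : R, 0 <= s <= 1 /\ grad psi y i 0 - grad psi x i 0 =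
    dotv (grad (fun u => grad psi u i 0) (x + s *: (y - x))) (y - x).
  pose g (s : R) := grad psi (x + s *: (y - x)) i 0.
  have dg (s : R) : is_derive s 1 g _ :=
    is_derive_path ((d2 i).1 (x + s *: (y - x))).
  have [|s] := @MVT R g _ 0 1 ltr01 (fun s _ => dg s).
    by apply: derivable_within_continuous => s _; case: (dg s).
  rewrite in_itv /= => /andP[s0 s1]; rewrite /g scale1r scale0r addr0 subrKC.
  by rewrite subr0 mulr1 => gE; exists s; rewrite !ltW.
have /choice[s sE] := mvt.
exists (fun i => x + s i *: (y - x)) => [i|]; first by exists (s i); case: (sE i).
apply/colP => i; rewrite [LHS]mxE [in X in _ + X]mxE (sE i).2 mxE.
by apply: eq_bigr => j _; rewrite !mxE.
Qed.

(** A supremum bounds the members of a set only if the set is bounded above. The hull lies in a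
    compact ball, on which the continuous entries of the Hessian are bounded; [E] then bounds the
    matrices entrywise. *)
Lemma HF_ub psi F x0 U H : C2_fun psi -> bounded_set (sublevel F x0) ->
  forall z : 'I_n -> 'cV[R]_n,
  (forall i, convex_hull (sublevel F x0) (z i)) ->
  frobenius (U^T *m rowwise_hess psi z *m U + H%:M) <= HF F psi x0 U H.
Proof.
move=> [_ d2] /convex_hull_bounded[M hM] z hz.
have hess_cont i j : continuous (fun y => hess psi y i j).
  under eq_fun do rewrite mxE.
  move=> y; apply: (@continuous_comp _ _ _ (grad (fun u => grad psi u i 0))
    (fun v : 'cV[R]_n => v j 0)); [exact: (d2 i).2 | exact: coord_continuous].
have hess_bnd i j : exists B, forall y, `|y| <= M -> `|hess psi y i j| <= B.
  have /compact_bounded[B [_ hB]] := continuous_compact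
    (continuous_subspaceT (hess_cont i j)) (@compact_norm_le _ n M).
  by exists (B + 1) => y yM; apply: hB; [rewrite ltrDl | exists y].
have /choice[B hB] : forall i, exists B : 'I_n -> R,
    forall j y, `|y| <= M -> `|hess psi y i j| <= B j.
  by move=> i; have [B hB] := choice (hess_bnd i); exists B.
pose E := \matrix_(i < p, j < p)
  (\sum_l (\sum_k `|U k i| * B k l) * `|U l j| + `|H|).
apply: ub_le_sup; last by exists z.
exists (frobenius E) => _ /= [w hw <-].
rewrite ler_wsqrtr//; apply: ler_sum => i _; apply: ler_sum => j _.
suff le_E : `|(U^T *m rowwise_hess psi w *m U + H%:M) i j| <= E i j.
  by rewrite -[leLHS]real_normK ?num_real// ler_sqr ?nnegrE// (le_trans _ le_E).
rewrite [leRHS]mxE mxE; apply: le_trans (ler_normD _ _) _; apply: lerD.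
  rewrite mxE; apply: le_trans (ler_norm_sum _ _ _) _; apply: ler_sum => l _.
  rewrite normrM ler_wpM2r// mxE; apply: le_trans (ler_norm_sum _ _ _) _.
  apply: ler_sum => k _; rewrite normrM !mxE ler_wpM2l//.
  by have := hB k l _ (hM _ (hw k)); rewrite !mxE.
by rewrite mxE; case: (i == j); rewrite ?mulr1n ?mulr0n ?normr0.
Qed.

(** Stationarity eliminates grad f(x), and [grad_diff_rowwise] leaves U^T grad F(x) = -(U^T Z U + H)
    d with Z a rowwise Hessian. Its points lie on the segment between two points of the sublevel
    set, hence in the hull. *)
Lemma scpg_gradient_bound (Us : set 'M[R]_(n, p)) (L : 'M[R]_(n, p) -> R) f psi
    x0 x U H (d : 'cV[R]_p) :
  let F := fun y => f y + psi y in
  assumption_A Us L f psi -> bounded_set (sublevel F x0) ->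
  F x <= F x0 -> F (x + U *m d) <= F x0 ->
  (forall e, subproblem f psi x U H d <= subproblem f psi x U H e) ->
  l2norm (U^T *m grad F x) <= HF F psi x0 U H * l2norm d.
Proof.
move=> F hA bF Fx Fy dmin; set y := x + U *m d.
have [[dpsi cpsi] d2] := A2_smooth hA.
have stat := subproblem_stationary dpsi dmin.
have gradF : grad F x = grad f x + grad psi x.
  by apply: gradD; [exact: (A1_smooth hA).1 | exact: dpsi].
have [z zseg zE] := grad_diff_rowwise x y (A2_smooth hA).
have yx : y - x = U *m d by rewrite /y addrC addKr.
have -> : U^T *m grad F x
    = - ((U^T *m rowwise_hess psi z *m U + H%:M) *m d).
  rewrite mulmxDl mul_scalar_mx -!mulmxA -yx -zE gradF mulmxDr mulmxBr.
  apply/eqP; rewrite -addr_eq0 -stat -/y; apply/eqP.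
  rewrite -addrA [_ - _ + _]addrAC [X in _ + X]addrC subrK.
  by rewrite (addrC (_ *m grad psi y)) addrA.
rewrite -scaleN1r l2normZ normrN1 mul1r; apply: le_trans (l2norm_mulmx _ _) _.
rewrite ler_wpM2r ?l2norm_ge0//; apply: (HF_ub _ _ (A2_smooth hA) bF) => i.
by have [s s01 ->] := zseg i; exact: convex_hull_segment.
Qed.

End GradientBound.

(** * Counting well-aligned iterations *)

Section Hits.
Context {T : Type} (W : nat -> set T).

Definition hits (w : T) (k : nat) : nat := (\sum_(i < k) `[< W i w >])%N.

Lemma hitsS w k : hits w k.+1 = (hits w k + `[< W k w >])%N.
Proof. by rewrite /hits big_ord_recr. Qed.

Lemma hits_leq w k l : (k <= l)%N -> (hits w k <= hits w l)%N.
Proof.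
elim: l => [|l IHl]; first by rewrite leqn0 => /eqP ->.
rewrite leq_eqVlt => /predU1P[->//|]; rewrite ltnS => /IHl h.
by rewrite hitsS (leq_trans h)// leq_addr.
Qed.

Lemma hits_le_time w k : (hits w k <= k)%N.
Proof.
elim: k => [|k IHk]; first by rewrite /hits big_ord0.
by rewrite hitsS -addn1 leq_add//; case: `[< _ >].
Qed.

Lemma hits_witness w k l : (hits w k < hits w l)%N ->
  exists i, [/\ (k <= i)%N, (i < l)%N & W i w].
Proof.
elim: l => [|l IHl]; first by rewrite /hits big_ord0.
have [kl|lk] := leqP k l; last by rewrite ltnNge hits_leq.
rewrite hitsS; case: asboolP => [Wl _|_]; first by exists l.
by rewrite addn0 => /IHl[i [ki il Wi]]; exists i; rewrite (leq_trans il).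
Qed.

Section HitIndex.
Variable w : T.
Hypothesis hits_unbounded : forall j, exists k, (j < hits w k)%N.

(** The count grows by at most one per step, so on its way past [j] it equals [j] just before some
    hit; the default value 0 of [hit_index] does not intervene. *)
Lemma hit_indexP j : W (hit_index W j w) w /\ hits w (hit_index W j w) = j.
Proof.
apply: (@xgetPex _ 0%N [set k | W k w /\ hits w k = j]).
have [k] := hits_unbounded j; elim: k => [|k IHk].
  by rewrite /hits big_ord0.
have [/IHk//|] := ltnP j (hits w k).
rewrite hitsS; case: asboolP => [Wk|_] hj; last by rewrite addn0 ltnNge hj.
by rewrite addn1 ltnS => jh; exists k; split=> //; apply: anti_leq; rewrite hj.
Qed.

Lemma hits_inj k l : W k w -> W l w -> hits w k = hits w l -> k = l.
Proof.
have lt_hits i j : W i w -> (i < j)%N -> (hits w i < hits w j)%N.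
  move=> Wi ij; apply: leq_trans (hits_leq w ij).
  by rewrite hitsS asboolT ?addn1.
move=> Wk Wl kl; case: (ltngtP k l) => // [/(lt_hits _ _ Wk)|/(lt_hits _ _ Wl)];
  by rewrite kl ltnn.
Qed.

Lemma hit_index_hits k : W k w -> hit_index W (hits w k) w = k.
Proof. by move=> Wk; have [Wi hi] := hit_indexP (hits w k); exact: hits_inj. Qed.

Lemma leq_hit_index j : (j <= hit_index W j w)%N.
Proof. by have [_ hj] := hit_indexP j; rewrite -{1}hj hits_le_time. Qed.

Lemma hit_index_ltS j : (hit_index W j w < hit_index W j.+1 w)%N.
Proof.
rewrite ltnNge; apply/negP => /(hits_leq w).
by rewrite !(hit_indexP _).2 ltnn.
Qed.

End HitIndex.

End Hits.

(** * Lower deviations of the number of hits *)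

Section Deviation.
Context {d : measure_display} {T : measurableType d} {R : realType}
  (P : probability T R) (V : topologicalType) (X : nat -> T -> V)
  (W : nat -> set T).
Hypothesis X_measurable : forall k, borel_measurable measurable (X k).
Hypothesis W_history : forall k, history X k.+1 (W k).

Lemma history_measurable k : history X k `<=` measurable.
Proof.
apply: smallest_sub; first exact: sigma_algebra_measurable.
by move=> _ [i _ [B oB ->]]; exact: X_measurable.
Qed.

Lemma history_le k l : (k <= l)%N -> history X k `<=` history X l.
Proof.
move=> kl; apply: sub_sigma_algebra2 => A [i ik hA].
by exists i => //; exact: leq_trans kl.
Qed.

Lemma W_measurable k : measurable (W k).
Proof. exact: (@history_measurable k.+1 (W k) (@W_history k)). Qed.

Definition few_hits (k m : nat) : set T := [set w | (hits W w k < m)%N].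

Lemma few_hits0 k : few_hits k 0 = set0.
Proof. by apply/seteqP; split. Qed.

Lemma few_hitsS k m :
  few_hits k.+1 m.+1 = few_hits k m `|` (few_hits k m.+1 `\` W k).
Proof.
apply/seteqP; split=> w; rewrite /few_hits /= hitsS.
  case: asboolP => [_|nW]; rewrite ?addn1 ?addn0 ?ltnS; first by left.
  by move=> ?; right; split.
by case: asboolP => [Ww|nW] [h|[h1 h2]] //; rewrite ?addn1 ?addn0// ltnW.
Qed.

Lemma few_hits_history k m : history X k (few_hits k m).
Proof.
pose S k := (@measurable _ (g_sigma_algebraType
  [set A | exists2 i, (i < k)%N & exists2 O, open O & A = X i @^-1` O])).
rewrite -[history X k]/(S k).
elim: k m => [|k IHk] [|m].
- by rewrite few_hits0; exact: measurable0.
- rewrite (_ : few_hits 0 m.+1 = setT); first exact: measurableT.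
  by apply/seteqP; split=> // w _; rewrite /few_hits /= /hits big_ord0.
- by rewrite few_hits0; exact: measurable0.
- have lift A : S k A -> S k.+1 A by exact: (@history_le k k.+1 (leqnSn k) A).
  rewrite few_hitsS; apply: measurableU; first by apply: lift; exact: IHk.
  by apply: measurableD; [by apply: lift; exact: IHk | exact: (@W_history k)].
Qed.

Lemma few_hits_measurable k m : measurable (few_hits k m).
Proof. exact: (@history_measurable k _ (@few_hits_history k m)). Qed.

Variables delta beta : R.
Hypothesis delta01 : 0 < delta < 1.
Hypothesis beta01 : 0 < beta < 1.
Hypothesis hB : forall (k : nat) (A : set T), history X k A ->
  ((1 - delta)%:E * P A <= P (A `&` W k))%E.

Let pr A := fine (P A).

Let prE A : measurable A -> P A = (pr A)%:E.
Proof. by move=> mA; rewrite /pr fineK// fin_num_measure. Qed.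

(** Fewer than [m] hits before [k] leave fewer than [m.+1] in any case. On the event of exactly [m]
    hits before [k], a past event, Assumption B bounds the probability of a miss at [k] by [delta]
    times that of the event. *)
Lemma few_hits_rec k m : pr (few_hits k.+1 m.+1)
  <= (1 - delta) * pr (few_hits k m) + delta * pr (few_hits k m.+1).
Proof.
have mW := W_measurable k.
have mA := few_hits_measurable k m; have mA1 := few_hits_measurable k m.+1.
set A := few_hits k m in mA *; set A1 := few_hits k m.+1 in mA1 *.
have AA1 : A `<=` A1 by move=> w /= /ltnW.
have mB : measurable (A1 `\` A) by exact: measurableD.
have mBD : measurable ((A1 `\` A) `\` W k) by exact: measurableD.
have mBI : measurable ((A1 `\` A) `&` W k) by exact: measurableI.
have hAA1 : pr A1 = pr (A1 `\` A) + pr A.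
  apply: EFin_inj; rewrite EFinD -!prE// (measureDI P mA1 mA).
  by rewrite (setIidr AA1).
have hBW : pr (A1 `\` A) = pr ((A1 `\` A) `\` W k) + pr ((A1 `\` A) `&` W k).
  by apply: EFin_inj; rewrite EFinD -!prE//; exact: measureDI.
have hBd : (1 - delta) * pr (A1 `\` A) <= pr ((A1 `\` A) `&` W k).
  rewrite -lee_fin EFinM -!prE//.
  apply: hB; rewrite -[history _ _]/(@measurable _ (g_sigma_algebraType
   [set A | exists2 i, (i < k)%N & exists2 O, open O & A = X i @^-1` O])).
  by apply: measurableD; exact: few_hits_history.
have -> : pr (few_hits k.+1 m.+1) = pr A + pr ((A1 `\` A) `\` W k).
  have mk1 := few_hits_measurable k.+1 m.+1.
  apply: EFin_inj; rewrite EFinD -!prE// few_hitsS -/A -/A1.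
  rewrite -measureU//; last first.
    by apply/seteqP; split=> // w [Aw [[_ nAw]]].
  congr (P _); apply/seteqP; split=> w.
    by move=> [|[? ?]]; [left | have [|] := pselect (A w); [left | right]].
  by move=> [|[[? ?] ?]]; [left | right].
rewrite hAA1; lra.
Qed.

(* A Chernoff bound with exponential weight 1 / (1 + beta) per hit: rho is the
   expected weight of one iteration hit with probability 1 - delta. *)
Let rho := 1 - (1 - delta) * beta / (1 + beta).

(** The bound satisfies the recursion of [few_hits_rec] with equality, because rho (1 + beta) = (1 -
    delta) + delta (1 + beta); an induction on [k] therefore replaces the exponential moment. *)
Lemma few_hits_le k m : pr (few_hits k m) <= rho ^+ k * (1 + beta) ^+ m.
Proof.
have /andP[d0 d1] := delta01; have /andP[b0 b1] := beta01.
have b10 : 0 < 1 + beta by lra.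
have rhoE : rho * (1 + beta) = (1 - delta) + delta * (1 + beta).
  by rewrite /rho; field; rewrite gt_eqF.
have rho0 : 0 <= rho by rewrite -(pmulr_lge0 _ b10) rhoE; nra.
elim: k m => [|k IHk] [|m].
- by rewrite few_hits0 /pr measure0 mulr_ge0// exprn_ge0// ltW.
- rewrite expr0 mul1r (@le_trans _ _ 1)//.
    by rewrite -lee_fin -prE ?probability_le1//; exact: few_hits_measurable.
  by rewrite exprn_ege1// lerDl ltW.
- by rewrite few_hits0 /pr measure0 mulr_ge0// exprn_ge0// ltW.
apply: le_trans (few_hits_rec k m) _.
have -> : rho ^+ k.+1 * (1 + beta) ^+ m.+1 =
   (1 - delta) * (rho ^+ k * (1 + beta) ^+ m)
   + delta * (rho ^+ k * (1 + beta) ^+ m.+1).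
  transitivity (rho ^+ k * (1 + beta) ^+ m * (rho * (1 + beta))).
    by rewrite !exprS; ring.
  by rewrite rhoE exprS; ring.
by rewrite lerD// ler_wpM2l// ?subr_ge0 ltW.
Qed.

Let C2 := (1 - beta) * (1 - delta).
(** The successor makes the count exceed [C2 * k] strictly outside [few_hits k (thr k)]; it costs a
    factor 1 + beta. *)
Let thr (k : nat) := (Num.trunc (C2 * k%:R)).+1.
Let rate := (1 - delta) * beta * ((1 + beta)^-1 - (1 - beta)).

(** Both powers are compared with exponentials through 1 + y <= exp y: rho^k decays at rate at least
    (1 - delta) beta / (1 + beta), the weight (1 + beta)^(C2 k) grows at rate at most beta C2, and
    [rate] is the difference. *)
Lemma few_hits_expR k :
  pr (few_hits k (thr k)) <= (1 + beta) * expR (- rate) ^+ k.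
Proof.
have /andP[d0 d1] := delta01; have /andP[b0 b1] := beta01.
have b10 : 0 < 1 + beta by lra.
have C20 : 0 <= C2 * k%:R by rewrite mulr_ge0// mulr_ge0; lra.
apply: le_trans (few_hits_le _ _) _.
rewrite exprS mulrCA ler_pM2l//.
have h1 : rho ^+ k <= expR (- ((1 - delta) * beta / (1 + beta))) ^+ k.
  apply: lerXn2r; rewrite ?nnegrE ?expR_ge0//; last exact: expR_ge1Dx.
  rewrite /rho subr_ge0 ler_pdivrMr// mul1r; nra.
have h2 : (1 + beta) ^+ Num.trunc (C2 * k%:R) <= expR (beta * C2) ^+ k.
  apply: (@le_trans _ _ (expR beta ^+ Num.trunc (C2 * k%:R))).
    by apply: lerXn2r; rewrite ?nnegrE ?expR_ge0// ?expR_ge1Dx// ltW.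
  have : (Num.trunc (C2 * k%:R))%:R <= C2 * k%:R by rewrite truncn_le.
  by rewrite -!expRM_natl ler_expR -(ler_pM2l b0); lra.
apply: le_trans (ler_pM _ _ h1 h2) _; rewrite ?exprn_ge0//.
- rewrite /rho subr_ge0 ler_pdivrMr// mul1r; nra.
- exact: ltW.
rewrite -exprMn -expRD le_eqVlt; apply/orP; left; apply/eqP.
congr (expR _ ^+ _); rewrite /rate /C2; field; by rewrite gt_eqF.
Qed.

Lemma eventually_many_hits :
  P (lim_sup_set (fun k => few_hits k (thr k))) = 0%E.
Proof.
have /andP[d0 d1] := delta01; have /andP[b0 b1] := beta01.
have b10 : 0 < 1 + beta by lra.
have rate0 : 0 < rate.
  (* Positivity of [rate] amounts to (1 - beta)(1 + beta) < 1. *)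
  rewrite /rate !mulr_gt0 ?subr_gt0// -[ltRHS]mul1r ltr_pdivlMr//; nra.
apply: lim_sup_set_cvg0 => [k|]; first exact: few_hits_measurable.
apply: (@le_lt_trans _ _ ((1 + beta) / (1 - expR (- rate)))%:E);
  last exact: ltry.
apply: lime_le; first exact: is_cvg_nneseries.
apply: nearW => N; apply: (@le_trans _ _
  (series (geometric (1 + beta) (expR (- rate))) N)%:E).
  rewrite /series /= -sumEFin; apply: lee_sum => k _.
  by rewrite prE ?lee_fin; [exact: few_hits_expR | exact: few_hits_measurable].
rewrite lee_fin geometric_le_lim ?expR_gt0 ?(ltW b10)//.
by rewrite ger0_norm ?expR_ge0// -expR0 ltr_expR oppr_lt0.
Qed.

Lemma many_hits_ge k w : ~ few_hits k (thr k) w -> C2 * k%:R < (hits W w k)%:R.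
Proof.
move=> /negP; rewrite -leqNgt => h.
by apply: (lt_le_trans (truncnS_gt _)); rewrite ler_nat.
Qed.

End Deviation.

(** * Measurability *)

Section Measurability.
Context {d : measure_display} {T : measurableType d} {R : realType}.

Lemma borel_measurable_comp (S : set (set T)) (V1 V2 : topologicalType)
    (X : T -> V1) (g : V1 -> V2) :
  continuous g -> borel_measurable S X -> borel_measurable S (g \o X).
Proof.
move=> cg mX B oB; rewrite comp_preimage; exact/mX/open_comp.
Qed.

Lemma borel_measurable_fun (X : T -> R) :
  borel_measurable measurable X -> measurable_fun setT X.
Proof.
move=> mX; apply: (measurability _ (RGenOpens.measurableE R)).
by move=> _ [_ [a [b ->]] <-]; rewrite setTI; apply: mX; exact: interval_open.
Qed.

Lemma measurable_coord m n (X : T -> 'M[R]_(m, n)) i j :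
  borel_measurable measurable X -> measurable_fun setT (fun w => X w i j).
Proof.
move=> mX; apply: borel_measurable_fun.
exact: (borel_measurable_comp (@coord_continuous R m n i j) mX).
Qed.

Lemma measurable_l2norm n (X : T -> 'cV[R]_n) :
  (forall i, measurable_fun setT (fun w => X w i 0)) ->
  measurable_fun setT (fun w => l2norm (X w)).
Proof.
move=> mX; apply: measurableT_comp.
  exact: continuous_measurable_fun (@sqrt_continuous R).
by apply: measurable_sum => i; exact: measurable_funX.
Qed.

(** The measurable space is arbitrary, since the lemma is applied to the sigma-algebra
    [history U k.+1] in place of the ambient one. *)
Lemma measurable_well_aligned n p (g : 'cV[R]_n -> 'cV[R]_n) (a : R)
    (X : T -> 'cV[R]_n) (U : T -> 'M[R]_(n, p)) :
  continuous g ->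
  borel_measurable measurable X -> borel_measurable measurable U ->
  measurable [set w | a * l2norm (g (X w)) <= l2norm ((U w)^T *m g (X w))].
Proof.
move=> cg mX mU; have mgX := borel_measurable_comp cg mX.
rewrite -[X in measurable X]setTI; apply: measurable_fun_le => //.
  apply: measurable_funM; first exact: measurable_cst.
  by apply: measurable_l2norm => i; exact: measurable_coord mgX.
apply: measurable_l2norm => i; under eq_fun do rewrite mxE.
apply: measurable_sum => j; apply: measurable_funM.
  by under eq_fun do rewrite mxE; exact: measurable_coord.
exact: measurable_coord mgX.
Qed.

Lemma measurable_l2norm_dist n (X Y : T -> 'cV[R]_n) (c : R) :
  borel_measurable measurable X -> borel_measurable measurable Y ->
  measurable [set w | l2norm (X w - Y w) <= c].
Proof.
move=> mX mY; rewrite -[X in measurable X]setTI; apply: measurable_fun_le => //.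
apply: measurable_l2norm => i; under eq_fun do rewrite mxE [X in _ + X]mxE.
by apply: measurable_funB; exact: measurable_coord.
Qed.

End Measurability.

(** * Recurrence of bounded sequences *)

Section Recurrence.
Context {R : realType} {n : nat}.

(** Bolzano-Weierstrass along the indices in [Q]: as [Q] is infinite, the image of the filter
    [within Q \oo] is proper, so it clusters in the compact ball. *)
Lemma recurrent_cluster (y : nat -> 'cV[R]_n) (Q : nat -> Prop) (M : R) :
  (forall k, `|y k| <= M) ->
  (forall m, exists2 k, (m <= k)%N & Q k) ->
  exists z : 'cV[R]_n, forall (B : set 'cV[R]_n) m, nbhs z B ->
    exists k, [/\ (m <= k)%N, Q k & B (y k)].
Proof.
move=> yM Qinf.
pose G := (y @ within Q \oo).
have G_proper : ProperFilter G.
  apply: fmap_proper_filter; apply: Build_ProperFilter => -[N _ hN].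
  by have [k Nk Qk] := Qinf N; exact: (hN k Nk Qk).
have [|z [_ zG]] := @compact_norm_le _ n M G G_proper.
  by exists 0%N => // k _ _; exact: yM.
exists z => B m zB.
have [|_ [[k [mk Qk] <-] Bk]] :=
    zG [set y k | k in [set k | (m <= k)%N /\ Q k]] B _ zB.
  by exists m => // k mk Qk; exists k.
by exists k.
Qed.

Lemma nbhs_l2norm_lt (z : 'cV[R]_n) (e : R) :
  0 < e -> nbhs z [set v | l2norm (v - z) < e].
Proof.
move=> e0; have : continuous (fun v : 'cV[R]_n => l2norm (v - z)).
  move=> v; apply: continuous_comp; last exact: l2norm_continuous.
  by apply: continuousB; [exact: cvg_id | exact: cst_continuous].
move=> lc; apply: (lc z [set r | r < e]); rewrite /= subrr l2norm0.
exact: open_nbhs_nbhs (conj (@open_lt R e) e0).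
Qed.

(* Replacing the distance to the random set of limit points by distances between
   iterates keeps the corresponding events measurable. *)
Lemma eventually_recurrent (y : nat -> 'cV[R]_n) (Q : nat -> Prop) (M c : R) :
  (forall k, `|y k| <= M) -> 0 < c ->
  exists N, forall k, (N <= k)%N -> Q k ->
    forall m, exists i, [/\ (m <= i)%N, Q i & l2norm (y i - y k) <= c].
Proof.
move=> yM c0; apply: contrapT => /forallNP noN.
(* If there were infinitely many bad indices, a bad [k] and a bad [i] beyond the threshold [m] of
   [k] would both lie within c / 2 of one cluster point, contradicting the badness of [k]. *)
pose bad k := Q k /\
  exists m, forall i, (m <= i)%N -> Q i -> c < l2norm (y i - y k).
have bad_inf m : exists2 k, (m <= k)%N & bad k.
  have /existsNP[k /not_implyP[mk /not_implyP[Qk /existsNP[l hl]]]] := noN m.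
  exists k => //; split=> //; exists l => i li Qi.
  by rewrite ltNge; apply/negP => ic; apply: hl; exists i.
have [z zP] := recurrent_cluster yM bad_inf.
have c2 : 0 < c / 2 by rewrite divr_gt0.
have [k [_ [Qk [m km]] kz]] := zP _ 0%N (nbhs_l2norm_lt z c2).
have [i [mi [Qi _] iz]] := zP _ m (nbhs_l2norm_lt z c2).
move: iz kz => /= iz kz; have := km i mi Qi; apply/negP.
rewrite -leNgt -(subrKA z); apply: le_trans (l2normD _ _) _.
rewrite (l2normB_sym z); lra.
Qed.

(** The visits of [y] at indices in [Q] to the closed ball of radius [c] around [v] have a cluster
    point [z], which is itself within [c] of [v]. Late visits are late terms of [u], so [z] is a
    limit point of [u]. *)
Lemma recurrent_dist_limit_points (y u : nat -> 'cV[R]_n) (Q : nat -> Prop)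
    (M c : R) (v : 'cV[R]_n) :
  (forall k, `|y k| <= M) ->
  (forall j, exists N, forall k, (N <= k)%N -> Q k ->
    exists2 j', (j <= j')%N & u j' = y k) ->
  (forall m, exists i, [/\ (m <= i)%N, Q i & l2norm (y i - v) <= c]) ->
  dist_set v (limit_points u) <= c.
Proof.
move=> yM uy hrec.
have [|z zP] := @recurrent_cluster y (fun k => Q k /\ l2norm (y k - v) <= c) M yM.
  by move=> m; have [i [mi Qi iv]] := hrec m; exists i.
have zv : l2norm (v - z) <= c.
  apply/ler_addgt0Pr => e e0.
  have [k [_ [_ kv] kz]] := zP _ 0%N (nbhs_l2norm_lt z e0).
  rewrite -(subrKA (y k)); apply: le_trans (l2normD _ _) _.
  by rewrite l2normB_sym lerD// ltW.
apply: le_trans zv; apply: ge_inf.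
  by exists 0 => _ [x _ <-]; exact: l2norm_ge0.
exists z => // A B [j _ jA] zB.
have [N uN] := uy j; have [k [Nk [Qk _] Bk]] := zP B N zB.
have [j' jj' uj'] := uN k Nk Qk.
by exists (y k); split=> //; rewrite -uj'; exact: jA.
Qed.

End Recurrence.

(** * Rates from the KL recursion *)

(** Discrete form of the fact that s' = - g s^(1 + th) makes s^(- th) grow at rate th g. It rests on
    ln (t / s) <= t / s - 1 <= - g s^th and on exp y >= 1 + y. *)
Lemma powR_opp_step {R : realType} (s t g th : R) :
  0 < s -> 0 < t -> 0 <= th -> t <= s - g * s `^ (1 + th) ->
  s `^ (- th) + th * g <= t `^ (- th).
Proof.
move=> s0 t0 th0 ts; have st0 : 0 < t / s by rewrite divr_gt0.
have sth : 0 < s `^ th by rewrite powR_gt0.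
have ln_le : ln (t / s) <= - (g * s `^ th).
  have := @le_ln1Dx _ (t / s - 1); rewrite subrKC => /(_ _)/le_trans; apply.
    by rewrite ltrBrDr addNr.
  rewrite lerBlDr ler_pdivrMr// mulrDl mul1r addrC mulNr -mulrA.
  move: ts; rewrite powRD ?(gt_eqF s0) ?implybT// powRr1 ?(ltW s0)//.
  by rewrite (mulrC s).
have -> : t `^ (- th) = s `^ (- th) * (t / s) `^ (- th).
  by rewrite -powRM ?ltW// mulrC divfK ?gt_eqF.
have -> : th * g = s `^ (- th) * (th * (g * s `^ th)).
  by rewrite powRN; field; rewrite gt_eqF.
rewrite -{1}[s `^ (- th)]mulr1 -mulrDr ler_wpM2l ?powR_ge0//.
rewrite /powR (gt_eqF st0); apply: le_trans (expR_ge1Dx _).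
by rewrite lerD2l mulNr -mulrN ler_wpM2l// lerNr.
Qed.

Section Rates.
Context {R : realType} {T : Type} (W : nat -> set T) (w : T).
Variables (D G : nat -> R) (C q sigma : R) (N : nat).
Hypothesis D_ge0 : forall k, 0 <= D k.
Hypothesis D_noninc : forall k, D k.+1 <= D k.
Hypothesis G_ge0 : forall k, 0 <= G k.
Hypothesis C_ge0 : 0 <= C.
Hypothesis q_gt0 : 0 < q.
Hypothesis sigma_gt0 : 0 < sigma.
Hypothesis decrease : forall k, W k w -> D k.+1 <= D k - C * G k ^+ 2.
(* C = 0 occurs when HFmax = 0, where C is a division by 0. *)
Hypothesis degenerate : C = 0 -> forall k, W k w -> G k = 0.
Hypothesis KL : forall k, (N <= k)%N -> W k w -> 0 < D k ->
  D k <= sigma * G k `^ q.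

Let gamma1 := C * sigma `^ (- (2 / q)).

Lemma gamma1_ge0 : 0 <= gamma1.
Proof. by rewrite mulr_ge0// powR_ge0. Qed.

Lemma D_anti k l : (k <= l)%N -> D l <= D k.
Proof.
elim: l => [|l IHl]; first by rewrite leqn0 => /eqP ->.
rewrite leq_eqVlt => /predU1P[->//|]; rewrite ltnS => /IHl.
exact: le_trans.
Qed.

Lemma D_degenerate k : C = 0 -> (N <= k)%N -> W k w -> D k = 0.
Proof.
move=> C0 Nk Wk; apply/eqP; rewrite eq_le D_ge0 andbT leNgt; apply/negP => Dk.
have := KL Nk Wk Dk; rewrite (degenerate C0 Wk) powR0 ?gt_eqF// mulr0.
by rewrite leNgt Dk.
Qed.

(** The KL inequality raised to the power 2 / q bounds [G k ^+ 2] from below by (D k / sigma)^(2 /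
    q). It is available only for D k > 0; for D k = 0 monotonicity suffices. *)
Lemma KL_decrease k : (N <= k)%N -> W k w ->
  D k.+1 <= D k - gamma1 * D k `^ (2 / q).
Proof.
move=> Nk Wk; have q2 : 0 < 2 / q by rewrite divr_gt0.
have [Dk|Dk] := ltP 0 (D k); last first.
  have Dk0 : D k = 0 by apply: le_anti; rewrite Dk D_ge0.
  by have := D_noninc k; rewrite Dk0 powR0 ?gt_eqF// mulr0 subr0.
apply: le_trans (decrease Wk) _; rewrite lerD2l lerN2 /gamma1 -mulrA ler_wpM2l//.
have -> : G k ^+ 2 = (G k `^ q) `^ (2 / q).
  by rewrite -powRrM mulrC divfK ?gt_eqF// powR_mulrn.
have -> : sigma `^ (- (2 / q)) * D k `^ (2 / q) = (D k / sigma) `^ (2 / q).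
  rewrite powRM ?invr_ge0 ?(ltW sigma_gt0)// -(powR_inv1 (ltW sigma_gt0)).
  by rewrite -powRrM mulN1r mulrC.
apply: ge0_ler_powR; rewrite ?nnegrE ?powR_ge0 ?(ltW q2)//.
  by rewrite divr_ge0// ltW.
by rewrite ler_pdivrMr// mulrC; exact: KL.
Qed.

(** Cleared of the denominator, the claim is D l + gamma1 (D l)^(2 / q) <= D k. It follows from
    [KL_decrease], whose power of D k is at least that of D l because D is nonincreasing. *)
Lemma superlinear_step k l : 2 < q -> (N <= k)%N -> (k < l)%N -> W k w ->
  D l <= 1 / (1 + gamma1 * D l `^ (2 / q - 1)) * D k.
Proof.
move=> q2 Nk kl Wk; have g0 := gamma1_ge0.
have den0 : 0 < 1 + gamma1 * D l `^ (2 / q - 1).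
  by rewrite ltr_pwDl// mulr_ge0// powR_ge0.
have Dlk : D l <= D k - gamma1 * D k `^ (2 / q).
  by apply: le_trans (D_anti kl) _; exact: KL_decrease.
rewrite div1r mulrC ler_pdivlMr// mulrDr mulr1.
have [Dl|Dl] := ltP 0 (D l); last first.
  have -> : D l = 0 by apply: le_anti; rewrite Dl D_ge0.
  by rewrite mul0r addr0.
have -> : D l * (gamma1 * D l `^ (2 / q - 1)) = gamma1 * D l `^ (2 / q).
  rewrite mulrCA -{1}[D l](powRr1 (D_ge0 l)) -powRD; last first.
    by rewrite (gt_eqF Dl) implybT.
  by rewrite addrC subrK.
apply: le_trans (lerD Dlk (lexx _)) _.
rewrite -addrA gerDl addrC subr_le0 ler_wpM2l//.
apply: ge0_ler_powR; rewrite ?nnegrE ?D_ge0 ?divr_ge0 ?(ltW q_gt0)//.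
exact: D_anti (ltnW kl).
Qed.

(* 1 - C / sigma < 0 forces D = 0 at every hit, but it may not be raised to powers. *)
Lemma linear_bound l : q = 2 -> (N <= l)%N ->
  D l <= Num.max 0 (1 - C / sigma) ^+ (hits W w l - hits W w N) * D N.
Proof.
move=> q2; elim: l => [|l IHl].
  by rewrite leqn0 => /eqP ->; rewrite subnn expr0 mul1r.
rewrite leq_eqVlt => /predU1P[->|]; first by rewrite subnn expr0 mul1r.
rewrite ltnS => Nl; rewrite hitsS; case: asboolP => Wl; last first.
  by rewrite addn0; apply: le_trans (D_noninc l) (IHl Nl).
rewrite addn1 subSn ?hits_leq// exprS -mulrA.
have := KL_decrease Nl Wl; rewrite q2 divff// powRr1// /gamma1 q2 divff//.
rewrite powR_inv1 ?(ltW sigma_gt0)// => h; have {}IHl := IHl Nl.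
apply: le_trans (ler_wpM2l _ IHl); last by rewrite le_max lexx.
apply: (@le_trans _ _ ((1 - C / sigma) * D l)); first by rewrite mulrBl mul1r.
by rewrite ler_wpM2r// le_max lexx orbT.
Qed.

(** Each hit adds at least gamma1 (2 - q) / q to the negative power of D, by [powR_opp_step] with 2
    / q = 1 + (2 - q) / q. At other times the same lemma with g = 0 shows that the power does not
    drop. *)
Lemma sublinear_growth l : q < 2 -> (N <= l)%N -> 0 < D l ->
  gamma1 * ((2 - q) / q) * ((hits W w l)%:R - (hits W w N)%:R)
   <= D l `^ (- ((2 - q) / q)).
Proof.
move=> q2; have th0 : 0 <= (2 - q) / q.
  by rewrite divr_ge0 ?subr_ge0 ?(ltW q2) ?(ltW q_gt0).
elim: l => [|l IHl].
  by rewrite leqn0 => /eqP ->; rewrite subrr mulr0 powR_ge0.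
rewrite leq_eqVlt => /predU1P[->|]; first by rewrite subrr mulr0 powR_ge0.
rewrite ltnS => Nl Dl1; have Dl : 0 < D l := lt_le_trans Dl1 (D_noninc l).
have {}IHl := IHl Nl Dl; rewrite hitsS; case: asboolP => Wl; last first.
  rewrite addn0; apply: le_trans IHl _.
  have := @powR_opp_step _ (D l) (D l.+1) 0 ((2 - q) / q) Dl Dl1 th0.
  by rewrite mul0r subr0 mulr0 addr0 => /(_ (D_noninc l)).
have := KL_decrease Nl Wl.
have -> : 2 / q = 1 + (2 - q) / q by field; rewrite gt_eqF.
move=> /(powR_opp_step Dl Dl1 th0)/(le_trans _); apply.
rewrite natrD /= mulr1n; move: IHl; lra.
Qed.

Lemma sublinear_rate l e : q < 2 -> (N <= l)%N ->
  0 < e -> e <= (hits W w l)%:R - (hits W w N)%:R ->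
  D l <= 1 / (gamma1 * ((2 - q) / q) * e) `^ (q / (2 - q)).
Proof.
move=> q2 Nl e0 eh; set th := (2 - q) / q.
have th0 : 0 < th by rewrite divr_gt0 ?subr_gt0.
have [Dl|Dl] := ltP 0 (D l); last by rewrite (le_trans Dl)// divr_ge0 ?powR_ge0.
(* When C = 0 the claimed bound is a division by 0, hence 0. As e > 0 there is a hit between N and
   l, and D vanishes from there on. *)
have Cn0 : C != 0.
  apply/eqP => C0; have hNl : (hits W w N < hits W w l)%N.
    by rewrite -(ltr_nat R) -subr_gt0 (lt_le_trans e0).
  have [i [Ni il Wi]] := hits_witness hNl.
  by move: Dl; rewrite ltNge -(D_degenerate C0 Ni Wi) D_anti// ltnW.
have C0 : 0 < C by rewrite lt_neqAle eq_sym Cn0.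
have g0 : 0 < gamma1 by rewrite mulr_gt0// powR_gt0.
have b0 : 0 < gamma1 * th * e by apply: mulr_gt0 => //; apply: mulr_gt0.
rewrite div1r -[leLHS]invrK lef_pV2 ?posrE ?invr_gt0 ?powR_gt0//.
have -> : (D l)^-1 = (D l `^ (- th)) `^ (q / (2 - q)).
  rewrite -powRrM -(powR_inv1 (D_ge0 l)); congr (_ `^ _); rewrite /th; field.
  by rewrite gt_eqF ?subr_gt0// gt_eqF.
apply: ge0_ler_powR; rewrite ?nnegrE ?powR_ge0 ?(ltW b0)//.
  by rewrite divr_ge0 ?(ltW q_gt0) ?subr_ge0 ?(ltW q2).
apply: le_trans (sublinear_growth q2 Nl Dl).
by rewrite ler_wpM2l// mulr_ge0 ?(ltW g0) ?(ltW th0).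
Qed.

Lemma linear_rate l e D0 : q = 2 -> (N <= l)%N ->
  0 < e -> e <= (hits W w l)%:R - (hits W w N)%:R -> D N <= D0 ->
  D l <= (1 - C * sigma^-1) `^ e * D0.
Proof.
move=> q2 Nl e0 eh DN; have D00 : 0 <= D0 := le_trans (D_ge0 N) DN.
have h0 : 0 < (hits W w l)%:R - (hits W w N)%:R := lt_le_trans e0 eh.
apply: le_trans (linear_bound q2 Nl) _.
move: h0 eh; rewrite -natrB ?hits_leq//; set h := (_ - _)%N => h0 eh.
(* If the base is not positive, the positive number of hits makes the left side 0. A positive base
   is at most 1, so lowering the exponent from h to the real number e enlarges the power. *)
have [g0|g0] := leP (1 - C * sigma^-1) 0.
  by rewrite expr0n -(pnatr_eq0 R) gt_eqF// mul0r mulr_ge0 ?powR_ge0.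
apply: ler_pM => //; first by rewrite exprn_ge0// ltW.
rewrite -powR_mulrn ?(ltW g0)// /powR (gt_eqF g0) ler_expR.
apply: ler_wnM2r eh; apply: ln_le0.
by rewrite gerDl oppr_le0 mulr_ge0// invr_ge0 ltW.
Qed.

End Rates.

(** * Paths of the algorithm *)

Section Paths.
Context {d : measure_display} {T : measurableType d} {R : realType}
  {n p : nat} (Us : set 'M[R]_(n, p)) (L : 'M[R]_(n, p) -> R)
  (f psi : 'cV[R]_n -> R) (x0 : 'cV[R]_n) (U : nat -> T -> 'M[R]_(n, p))
  (eta : nat -> T -> R) (dir : nat -> T -> 'cV[R]_p) (x : nat -> T -> 'cV[R]_n).
Let F : 'cV[R]_n -> R := fun y => f y + psi y.
Hypothesis hA : assumption_A Us L f psi.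
Hypothesis hS : SCPG Us L f psi x0 U eta dir x.

Lemma objective_C1 : (forall y, differentiable F y) /\ continuous (grad F).
Proof.
have [df cf] := A1_smooth hA; have [[dpsi cpsi] _] := A2_smooth hA.
split=> [y|]; first exact: differentiableD.
have -> : grad F = grad f + grad psi.
  by apply/funext => y; apply: gradD; [exact: df | exact: dpsi].
by move=> y; apply: continuousD; [exact: cf | exact: cpsi].
Qed.

Lemma objective_continuous : continuous F.
Proof. by move=> y; apply: differentiable_continuous; exact: objective_C1.1. Qed.

Lemma objective_step k w :
  F (x k.+1 w) <= F (x k w) - eta k w / 2 * l2norm (dir k w) ^+ 2.
Proof.
rewrite (x_step hS) /F.
exact: scpg_decrease hA (U_sampled hS k w) (dir_argmin hS k w).
Qed.

Lemma objective_noninc k w : F (x k.+1 w) <= F (x k w).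
Proof.
apply: le_trans (objective_step k w) _; rewrite gerDl oppr_le0.
by rewrite mulr_ge0 ?sqr_ge0// divr_ge0// ltW// (eta_gt0 hS).
Qed.

Lemma iterates_sublevel k w : F (x k w) <= F x0.
Proof.
elim: k => [|k]; first by rewrite (x_start hS).
exact: le_trans (objective_noninc k w).
Qed.

Lemma objective_limit w :
  let Fstar := limn (fun k => F (x k w)) in
  F (x k w) @[k --> \oo] --> Fstar /\ forall k, Fstar <= F (x k w).
Proof.
have ni : nonincreasing_seq (fun k => F (x k w)).
  by apply/nonincreasing_seqP => k; exact: objective_noninc.
have cv : cvgn (fun k => F (x k w)).
  apply: nonincreasing_is_cvgn => //.
  have [y hy] := A3_minimizer hA.
  by exists (F y) => _ [k _ <-]; exact: hy.
by split=> // k; exact: nonincreasing_cvgn_ge.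
Qed.

Hypothesis bF : bounded_set (sublevel F x0).

Lemma iterates_bounded : exists M, forall k w, `|x k w| <= M.
Proof.
move: bF => [M [_ /(_ (M + 1))]]; rewrite ltrDl ltr01 => /(_ isT) hM.
by exists (M + 1) => k w; apply: hM; exact: iterates_sublevel.
Qed.

Variables (alpha eta_min HFmax : R).
Hypothesis alpha_gt0 : 0 < alpha.
Hypothesis eta_min_gt0 : 0 < eta_min.
Hypothesis eta_ge : forall k w, eta_min <= eta k w.
Hypothesis HF_le :
  forall k w, HF F psi x0 (U k w) (Hf Us L psi (U k w) (eta k w)) <= HFmax.
Let W := well_aligned F alpha U x.
Let C := alpha ^+ 2 * eta_min / (2 * HFmax ^+ 2).

Lemma well_aligned_grad k w : W k w ->
  alpha * l2norm (grad F (x k w)) <= HFmax * l2norm (dir k w).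
Proof.
move=> Wk; apply: le_trans Wk _.
apply: (@le_trans _ _ (HF F psi x0 (U k w) (Hf Us L psi (U k w) (eta k w))
                       * l2norm (dir k w))).
  apply: scpg_gradient_bound hA bF _ _ (dir_argmin hS k w).
  - exact: iterates_sublevel.
  - by rewrite -(x_step hS); exact: iterates_sublevel.
by rewrite ler_wpM2r ?l2norm_ge0.
Qed.

Lemma well_aligned_decrease k w : W k w ->
  F (x k.+1 w) <= F (x k w) - C * l2norm (grad F (x k w)) ^+ 2.
Proof.
move=> Wk; have := well_aligned_grad Wk.
set g := l2norm (grad F _); set D := l2norm (dir k w) => gD.
have g0 : 0 <= g := l2norm_ge0 _; have D0 : 0 <= D := l2norm_ge0 _.
apply: le_trans (objective_step k w) _; rewrite -/D lerD2l lerN2.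
apply: (@le_trans _ _ (eta_min / 2 * D ^+ 2)); last first.
  by rewrite ler_wpM2r ?sqr_ge0// ler_pM2r ?invr_gt0.
have [H0|H0] := eqVneq HFmax 0.
  rewrite /C H0 expr0n mulr0 invr0 mulr0 mul0r.
  by rewrite mulr_ge0 ?sqr_ge0// divr_ge0 ?ltW.
have H2 : 0 < HFmax ^+ 2 by rewrite exprn_even_gt0.
have -> : C * g ^+ 2 = eta_min / 2 * ((alpha * g) ^+ 2 / HFmax ^+ 2).
  by rewrite /C; field.
rewrite ler_pM2l ?divr_gt0// ler_pdivrMr// -exprMn (mulrC D).
have ag : 0 <= alpha * g by rewrite mulr_ge0// ltW.
by rewrite ler_sqr ?nnegrE// (le_trans ag).
Qed.

Lemma well_aligned_degenerate k w :
  C = 0 -> W k w -> l2norm (grad F (x k w)) = 0.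
Proof.
move=> /eqP; rewrite mulf_eq0 (gt_eqF (mulr_gt0 _ _)) ?exprn_gt0//=.
rewrite invr_eq0 mulf_eq0 pnatr_eq0 /= expf_eq0 /= => /eqP H0.
move=> /well_aligned_grad.
rewrite H0 mul0r pmulr_rle0// => h.
by apply: le_anti; rewrite h l2norm_ge0.
Qed.

Lemma well_aligned_history k : history U k.+1 (W k).
Proof.
pose S := g_sigma_algebraType
  [set A | exists2 i, (i < k.+1)%N & exists2 B, open B & A = U i @^-1` B].
apply: (@measurable_well_aligned _ S R n p (grad F) alpha (x k) (U k)).
- exact: objective_C1.2.
- move=> B oB; apply: (@history_le _ T _ U k k.+1 (leqnSn k) _).
  exact: (x_adapted hS).
- by move=> B oB; apply: sub_sigma_algebra; exists k => //; exists B.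
Qed.

Lemma iterate_measurable k : borel_measurable measurable (x k).
Proof.
move=> B oB; apply: (history_measurable (U_measurable hS) (k := k)).
exact: (x_adapted hS).
Qed.

End Paths.

(** * Tails of sequences of events *)

Section Tail.
Context {d : measure_display} {T : measurableType d} {R : realType}
  (P : probability T R).

(** The bound [N] may depend on the path: events that eventually cease on every path need no rate of
    decay for their probabilities. *)
Lemma lim_sup_setU_transient (A B : nat -> set T) :
  (forall w, exists N, forall k, (N <= k)%N -> ~ B k w) ->
  lim_sup_set (fun k => A k `|` B k) = lim_sup_set A.
Proof.
move=> Bfin; apply/seteqP; split=> w h m _; last first.
  by have [k mk Ak] := h m Logic.I; exists k => //; left.
have [N hN] := Bfin w.
have [k /= mk [Ak|Bk]] := h (maxn m N) Logic.I.
  by exists k => //=; rewrite (leq_trans _ mk)// leq_maxl.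
by case: (hN k _ Bk); rewrite (leq_trans _ mk)// leq_maxr.
Qed.

(** Continuity from above: the tail unions decrease to the limit superior. *)
Lemma tail_probability_small (A : nat -> set T) (e : R) :
  (forall k, measurable (A k)) -> P (lim_sup_set A) = 0%E -> 0 < e ->
  exists M, (P (\bigcup_(k in [set k | (M <= k)%N]) A k) <= e%:E)%E.
Proof.
move=> mA PA e0.
have cv : P (\bigcup_(k in [set k | (m <= k)%N]) A k) @[m --> \oo] --> 0%E.
  rewrite -PA; apply: lim_sup_set_cvg => //.
  apply: (@le_lt_trans _ _ 1%E); last exact: ltry.
  by apply: probability_le1; apply: bigcup_measurable.
have [|N _ hN] := cv [set y | (y < e%:E)%E].
  apply: open_nbhs_nbhs; split; first exact: open_ereal_lt_ereal.
  by rewrite /= lte_fin.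
by exists N; apply/ltW/hN => /=.
Qed.

Lemma cond_prob_sub (E A : set T) :
  (0 < P E)%E -> measurable E -> E `<=` A -> cond_prob P E A = 1.
Proof.
move=> PE mE EA; rewrite /cond_prob (setIidr EA) divff// gt_eqF//.
by rewrite fine_gt0// PE (le_lt_trans (probability_le1 _ mE)) ?ltry.
Qed.

End Tail.

(** * The good event and the three rates *)

Theorem theorem2 (R : realType) (d : measure_display) (T : measurableType d)
    (P : probability T R) (n p : nat)
    (Us : set 'M[R]_(n, p)) (L : 'M[R]_(n, p) -> R) (f psi : 'cV[R]_n -> R)
    (x0 : 'cV[R]_n) (U : nat -> T -> 'M[R]_(n, p)) (eta : nat -> T -> R)
    (dir : nat -> T -> 'cV[R]_p) (x : nat -> T -> 'cV[R]_n)
    (alpha delta eta_min HFmax q sigma gam eps beta : R) :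
  let F : 'cV[R]_n -> R := fun y => f y + psi y in
  let Fstar : T -> R := fun w => limn (fun k => F (x k w)) in
  let W := well_aligned F alpha U x in
  let kk := hit_index W in
  let X0 := fun w => limit_points (fun j => x (kk j w) w) in
  let C := alpha ^+ 2 * eta_min / (2 * HFmax ^+ 2) in
  let gamma1 := C * sigma `^ (- (2 / q)) in
  let gamma2 := 1 - C * sigma^-1 in
  let C1 := (2 - q) / q in
  let C2 := (1 - beta) * (1 - delta) in
  assumption_A Us L f psi ->
  SCPG Us L f psi x0 U eta dir x ->
  0 < alpha < 1 -> 0 < delta < 1 ->
  assumption_B P U W delta ->
  bounded_set (sublevel F x0) ->
  1 < q -> 0 < sigma -> 0 < gam -> 0 < eps ->
  {ae P, forall w, KL_property F (X0 w) (Fstar w) q sigma gam eps} ->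
  0 < eta_min -> (forall k w, eta_min <= eta k w) ->
  (forall k w, HF F psi x0 (U k w) (Hf Us L psi (U k w) (eta k w)) <= HFmax) ->
  0 < beta < 1 ->
  forall delta' : R, 0 < delta' ->
  exists (j' : nat) (E : set T),
    [/\ measurable E, ((1 - delta')%:E <= P E)%E &
     forall w, E w ->
     [/\ (0 < kk j' w)%N,
      forall K : nat,
        Num.max ((1 + j'%:R) / ((1 - beta) * (1 - delta)) - 1) (kk j' w)%:R
          < K%:R ->
        (q < 2 ->
          1 - expR (- (beta ^+ 2 / 2 * (1 - delta) * (K%:R + 1)))
          <= cond_prob P E [set v | F (x K v) - Fstar v
               <= 1 / (gamma1 * C1 * (C2 * (K%:R + 1) - (j'%:R + 1)))
                        `^ (q / (2 - q))]) /\
        (q = 2 ->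
          1 - expR (- (beta ^+ 2 / 2 * (1 - delta) * (K%:R + 1)))
          <= cond_prob P E [set v | F (x K v) - Fstar v
               <= gamma2 `^ (C2 * (K%:R + 1) - (j'%:R + 1))
                  * (F x0 - Fstar v)])
      & 2 < q -> forall j : nat, (kk j' w <= kk j w)%N ->
        let D := fun i => F (x (kk i w) w) - Fstar w in
        D j.+1 <= 1 / (1 + C * sigma `^ (- (2 / q)) * D j.+1 `^ (2 / q - 1))
                  * D j]].
Proof.
move=> F Fstar W kk X0 C gamma1 gamma2 C1 C2 hA hS /andP[alpha0 _] delta01 hB bF
  q1 sigma0 gam0 eps0 KLae etam0 eta_ge HF_le beta01 delta' delta'0.
have /andP[d0 d1] := delta01; have /andP[b0 b1] := beta01.
have C20 : 0 < C2 by rewrite mulr_gt0 ?subr_gt0.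
have C21 : C2 <= 1 by rewrite /C2; nra.
have cF : continuous F := objective_continuous hA.
have mU := U_measurable hS.
have mx k : borel_measurable measurable (x k) by exact: (iterate_measurable hS).
have hW k : history U k.+1 (W k) by exact: (well_aligned_history hA hS).
have mW k : measurable (W k).
  by apply: (history_measurable mU (k := k.+1)); exact: hW.
have [M0 xM0] := iterates_bounded hA hS bF.
pose thr k := (Num.trunc (C2 * k%:R)).+1.
(* [recurrent k] and [low k] are measurable substitutes for the two conditions of the KL region,
   closeness to the limit points and F(x_k) < F_* + eps. The margin eps / 2 restores the strict
   inequality in the limit. *)
pose recurrent k := \bigcap_m \bigcup_(i in [set i | (m <= i)%N])
  (W i `&` [set w | l2norm (x i w - x k w) <= gam]).
pose low k := \bigcap_m [set w | F (x k w) <= F (x m w) + eps / 2].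
pose transient k := (W k `\` recurrent k) `|` ~` low k.
pose bad k := few_hits W k (thr k) `|` transient k.
have mbad k : measurable (bad k).
  apply: measurableU; first exact: few_hits_measurable mU hW k _.
  apply: measurableU.
    apply: measurableD => //; apply: bigcapT_measurable => m.
    apply: bigcup_measurable => i _; apply: measurableI => //.
    exact: measurable_l2norm_dist.
  apply/measurableC/bigcapT_measurable => m.
  have mFx i : measurable_fun setT (fun w => F (x i w)).
    exact/borel_measurable_fun/(borel_measurable_comp cF).
  rewrite -[X in measurable X]setTI; apply: measurable_fun_le => //.
  by apply: measurable_funD.
have transientP w : exists N, forall k, (N <= k)%N -> ~ transient k w.
  have [N1 hN1] := eventually_recurrent (fun k => W k w) (xM0^~ w) gam0.
  have [cvF Fge] := objective_limit hA hS w.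
  have [N2 _ hN2] : \forall k \near \oo, F (x k w) < Fstar w + eps / 2.
    apply: (cvF [set y | y < Fstar w + eps / 2]).
    apply: (open_nbhs_nbhs (conj (@open_lt R _) _)) => /=.
    by rewrite ltrDl divr_gt0.
  exists (maxn N1 N2) => k; rewrite geq_max => /andP[N1k N2k] [[Wk]|]; apply.
    by move=> m _; have [i [mi Wi ik]] := hN1 k N1k Wk m; exists i.
  by move=> m _ /=; apply/ltW/(lt_le_trans (hN2 k N2k)); rewrite lerD2r; exact: Fge.
have Pbad : P (lim_sup_set bad) = 0%E.
  rewrite (lim_sup_setU_transient _ transientP).
  by have := eventually_many_hits mU hW delta01 beta01 hB.
(* The cap 1/2 keeps the probability of [E] positive also for delta' >= 1, so that conditioning on
   [E] makes sense. *)
pose e := Num.min delta' 2^-1.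
have e0 : 0 < e by rewrite lt_min delta'0 invr_gt0 ltr0n.
have [M hM] := tail_probability_small mbad Pbad e0.
have [N0 [mN0 PN0 KLN0]] := KLae.
pose late := \bigcup_(k in [set k | (M <= k)%N]) bad k.
have mlate : measurable late by apply: bigcup_measurable.
(* The deviation event of every K >= M is removed from E, so that the rates hold
   on all of E and the conditional probabilities are equal to 1. *)
pose E := ~` (N0 `|` late).
have mE : measurable E by apply/measurableC/measurableU.
have PE : ((1 - e)%:E <= P E)%E.
  rewrite probability_setC; last exact: measurableU.
  rewrite EFinB leeB//; apply: le_trans (measureU2 _ _ _) _ => //.
  rewrite -[leRHS]add0e; apply: leeD => //.
  by rewrite le_eqVlt; apply/orP; left; apply/eqP.
have PE0 : (0 < P E)%E.
  apply: lt_le_trans PE; rewrite lte_fin subr_gt0 gt_min.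
  by rewrite invf_lt1 ?ltr1n ?orbT.
have goodKL v : E v -> KL_property F (X0 v) (Fstar v) q sigma gam eps.
  by move=> /not_orP[nN0 _]; apply: contrapT => /KLN0.
have good v k : E v -> (M <= k)%N -> ~ bad k v.
  by move=> /not_orP[_ nl] Mk bk; apply: nl; exists k.
have many v k : E v -> (M <= k)%N -> C2 * k%:R < (hits W v k)%:R.
  by move=> Ev /(good v k Ev)/not_orP[/many_hits_ge].
have unbounded v : E v -> forall j, exists k, (j < hits W v k)%N.
  move=> Ev j; pose k := maxn M (Num.trunc (j%:R / C2)).+1.
  exists k; rewrite -(ltr_nat R); apply: le_lt_trans (many v k Ev (leq_maxl _ _)).
  rewrite mulrC -ler_pdivrMr//; apply: (le_trans (ltW (truncnS_gt _))).
  by rewrite ler_nat leq_maxr.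
(* [j'] serves both as an index and as a time: on [E] the hit of index [j'] occurs no earlier than
   time [j'], hence not before [M], and at most [j'] hits precede time [j']. The 1 makes the hit
   time positive. *)
pose j' := maxn M 1.
pose D v k := F (x k v) - Fstar v.
pose G v k := l2norm (grad F (x k v)).
have D_ge0 v k : 0 <= D v k by rewrite subr_ge0; exact: (objective_limit hA hS v).2.
have G_ge0 v k : 0 <= G v k by exact: l2norm_ge0.
have D_noninc v k : D v k.+1 <= D v k.
  by rewrite lerD2r; exact: objective_noninc hA hS k v.
have C0 : 0 <= C by rewrite divr_ge0 // mulr_ge0 ?sqr_ge0 ?(ltW etam0).
have q0 : 0 < q := lt_trans ltr01 q1.
have decr v k : W k v -> D v k.+1 <= D v k - C * G v k ^+ 2.
  move=> Wk; have : F (x k.+1 v) <= F (x k v) - C * G v k ^+ 2.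
    exact: (well_aligned_decrease hA hS bF alpha0 etam0 eta_ge HF_le Wk).
  rewrite /D; lra.
have degen v : C = 0 -> forall k, W k v -> G v k = 0.
  move=> C00 k Wk.
  exact: (well_aligned_degenerate hA hS bF alpha0 etam0 HF_le C00 Wk).
have KLj v k : E v -> (j' <= k)%N -> W k v -> 0 < D v k ->
    D v k <= sigma * G v k `^ q.
  move=> Ev; rewrite geq_max => /andP[Mk _] Wk Dk.
  have /not_orP[_ /not_orP[nrec /contrapT hlow]] := good v k Ev Mk.
  have hrec : recurrent k v by apply: contrapT => nr; apply: nrec.
  apply: (goodKL v Ev).2.
    apply: (@recurrent_dist_limit_points _ _ (x^~ v) _ (fun k => W k v) M0 _ _ (xM0^~ v)).
      move=> j; exists (kk j v) => i ji Wi; exists (hits W v i).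
        by rewrite -{1}(hit_indexP (unbounded v Ev) j).2 hits_leq.
      by rewrite /kk (hit_index_hits (unbounded v Ev) Wi).
    by move=> m; have [i /= mi [Wi ik]] := hrec m Logic.I; exists i.
  rewrite -subr_gt0 Dk /=.
  have [cvF _] := objective_limit hA hS v.
  apply: (@le_lt_trans _ _ (Fstar v + eps / 2)); last first.
    by rewrite ltrD2l ltr_pdivrMr// mulr_natr mulr2n ltrDl.
  rewrite -lerBlDr; apply: limr_ge; first exact: cvgP cvF.
  by apply: nearW => m; rewrite lerBlDr; exact: hlow.
(* More than C2 (K + 1) hits occur before time K + 1, at most one of them at time K and at most j'
   before time j'. This yields the offset j' + 1, and the lower bound on K makes the difference
   positive. *)
have count v K : E v -> (1 + j'%:R) / C2 - 1 < K%:R ->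
    [/\ (j' <= K)%N, 0 < C2 * (K%:R + 1) - (j'%:R + 1) &
     C2 * (K%:R + 1) - (j'%:R + 1) <= (hits W v K)%:R - (hits W v j')%:R].
  move=> Ev; rewrite ltrBlDr ltr_pdivrMr// mulrC => hK.
  have jK : (j' <= K)%N.
    rewrite -(ler_nat R); have : C2 * (K%:R + 1) <= K%:R + 1.
      by rewrite -[leRHS]mul1r ler_wpM2r// addr_ge0.
    lra.
  have MK : (M <= K.+1)%N by rewrite leqW// (leq_trans (leq_maxl _ _) jK).
  have := many v K.+1 Ev MK; rewrite hitsS natrD -natr1.
  have : (`[< W K v >] : nat)%:R <= 1 :> R by case: `[< _ >].
  have : (hits W v j')%:R <= j'%:R :> R by rewrite ler_nat hits_le_time.
  by split=> //; lra.
exists j', E; split=> //.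
  by apply: le_trans PE; rewrite lee_fin lerD2l lerN2 ge_min lexx.
move=> w Ew; split.
- apply: leq_trans (leq_hit_index (unbounded w Ew) j'); exact: leq_maxr.
- move=> K; rewrite gt_max => /andP[hK _].
  have expR_le1 (y : R) : 1 - expR y <= 1 by rewrite gerBl expR_ge0.
  split=> hq; rewrite cond_prob_sub// => v Ev /=; have [jK ej ejh] := count v K Ev hK.
  + apply: (sublinear_rate (D_ge0 v) (D_noninc v) (G_ge0 v) C0 q0 sigma0 (decr v) (degen v)
      (fun k => KLj v k Ev)) => //.
  + apply: (linear_rate (D_ge0 v) (D_noninc v) (G_ge0 v) C0 q0 sigma0 (decr v)
      (fun k => KLj v k Ev) hq jK ej ejh).
    by rewrite lerD2r; exact: iterates_sublevel hA hS j' v.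
- move=> q2 j jj; apply: (superlinear_step (D_ge0 w) (D_noninc w) (G_ge0 w) C0 q0 sigma0
    (decr w) (fun k => KLj w k Ew)) => //.
  + exact: leq_trans (leq_hit_index (unbounded w Ew) j') jj.
  + exact: hit_index_ltS (unbounded w Ew) j.
  + exact: (hit_indexP (unbounded w Ew) j).1.
Qed.
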